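(* Let $n_x\ge 1$, $A,A_{d_1},A_{d_2}\in\mathbf{R}^{n_x\times n_x}$ and $\tau>0$, and consider the time delay system $$\dot{x}(t)=Ax(t)+A_{d_1}x(t-\tau)+A_{d_2}\int_{t-\tau}^{t}x(s)\,ds,\quad t\ge 0,\qquad x_0(t)=\varphi(t),\ t\in[-\tau,0].$$ Let $M>0$, $m_1\ge 0$, $m_2\ge 1$ and $\nu_{1,j}\ge 0$ $(j=0,\ldots,m_1)$, $\nu_{2,j}\ge 0$ $(j=0,\ldots,m_2)$ be integers satisfying $m_1+\nu_{1,j}<M$ and $m_2+\nu_{2,j}\le M$ for all $j$. If there exist matrices $P\in\mathbf{S}_{n_x(M+1)}$, $Q_j\in\mathbf{S}^+_{n_x}$ $(j=0,\ldots,m_1)$ and $R_j\in\mathbf{S}^+_{n_x}$ $(j=1,\ldots,m_2)$ such that the linear matrix inequalities $$\Psi^0_{M,m_1}(\tau)>0,\qquad \Psi^1_M(\tau)+\Psi^2_{M,m_1}+\Psi^{3,1}_{M,m_2}(\tau)-\Psi^{3,2}_{M,m_2}(\tau)<0$$ hold (the matrices $\Psi$ are defined in the context), then the system is asymptotically stable.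
   Context: $\mathbf{S}_n$ and $\mathbf{S}_n^+$ are the sets of symmetric, respectively symmetric positive definite, real $n\times n$ matrices; $>0$ and $<0$ for symmetric matrices mean positive and negative definite; $\otimes$ is the Kronecker product; $I=I_{n_x}$; $0$ denotes zero blocks of compatible size; $\mathrm{diag}$ denotes (block) diagonal matrices. Polynomials. For integers $k,n\ge 0$ let $P_{k,0}(x)\equiv 1$ and $P_{k,n}(x)=\frac{1}{n!}\frac{1}{x^k}\frac{d^n}{dx^n}\left(x^k(x^2-x)^n\right)$, $n\ge 1$. Let $q_{k,k+i}(x)=x^kP_{k,i}(x)$ (degree $k+i$). If $k+i\le M-1$, define $\xi^k_{i,l}$ by $q_{k,k+i}(x)=\sum_{l=0}^{M-1}\xi^k_{i,l}P_{0,l}(x)$. If $k+i\le M$, define $\zeta^k_{i,l}$ by $q'_{k,k+i}(x)=\sum_{l=0}^{M-1}\zeta^k_{i,l}P_{0,l}(x)$ (derivative in $x$). Put $$\underline{\xi}^k_i=(\xi^k_{i,0},\ldots,\xi^k_{i,M-1}),\quad \underline{\zeta}^0_i=(1,(-1)^{i+1},-\zeta^0_{i,0},\ldots,-\zeta^0_{i,M-1}),\quad \underline{\zeta}^k_i=(1,0,-\zeta^k_{i,0},\ldots,-\zeta^k_{i,M-1})\ (k>0).$$ $\Xi_k\in\mathbf{R}^{(\nu_{1,k}+1)\times M}$ has rows $\underline{\xi}^k_0,\ldots,\underline{\xi}^k_{\nu_{1,k}}$; $\mathcal{Z}_k\in\mathbf{R}^{(\nu_{2,k}+1)\times(M+2)}$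 has rows $\underline{\zeta}^k_0,\ldots,\underline{\zeta}^k_{\nu_{2,k}}$; $\widetilde{\mathcal{L}}_0\in\mathbf{R}^{M\times(M+2)}$ has rows $\underline{\zeta}^0_0,\ldots,\underline{\zeta}^0_{M-1}$. Further matrices: $$\mathcal{Q}^{(k)}_j=\mathrm{diag}\{(j+1)Q_k,(j+3)Q_k,\ldots,(j+2\nu_{1,j}+1)Q_k\},\qquad \mathcal{R}^{(j)}_{j-1}=\mathrm{diag}\{jR_j,(j+2)R_j,\ldots,(j+2\nu_{2,j-1})R_j\},$$ $$\mathcal{A}=(A,\ A_{d_1},\ \tau A_{d_2},\ 0,\ldots,0)\in\mathbf{R}^{n_x\times n_x(M+2)},\qquad \Lambda_M=\begin{bmatrix}\mathcal{A}\\ \widetilde{\mathcal{L}}_0\otimes I\end{bmatrix},\qquad \Gamma_M=\begin{bmatrix}1&0&0\\0&0&\tau I_M\end{bmatrix}\otimes I .$$ The matrices in the inequalities are $$\Psi^0_{M,m_1}(\tau)=\tau P+\sum_{j=0}^{m_1}\mathrm{diag}\left\{0,\ (\Xi_j\otimes I)^T\mathcal{Q}^{(j)}_j(\Xi_j\otimes I)\right\}\quad(\text{the leading }0\text{ is }n_x\times n_x),$$ $$\Psi^1_M(\tau)=\Gamma_M^TP\Lambda_M+\Lambda_M^TP\Gamma_M,$$ $$\Psi^2_{M,m_1}=\mathrm{diag}\left\{\sum_{j=0}^{m_1}Q_j,\ -Q_0,\ -\sum_{j=1}^{m_1}j\,(\Xi_{j-1}\otimes I)^T\mathcal{Q}^{(j)}_{j-1}(\Xi_{j-1}\otimes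 I)\right\},$$ $$\Psi^{3,1}_{M,m_2}(\tau)=\tau\mathcal{A}^T\left(\sum_{j=1}^{m_2}R_j\right)\mathcal{A},\qquad \Psi^{3,2}_{M,m_2}(\tau)=\frac{1}{\tau}\sum_{j=1}^{m_2}j\,(\mathcal{Z}_{j-1}\otimes I)^T\mathcal{R}^{(j)}_{j-1}(\mathcal{Z}_{j-1}\otimes I).$$ Asymptotic stability is that of the zero solution in the usual Lyapunov sense for functional differential equations. *)

(* Defs.v *)
From HB Require Import structures.
From mathcomp Require Import all_boot all_order all_algebra.
From mathcomp Require Import all_classical all_reals all_analysis.
From mathcomp.real_closed Require Export mxtens.

Set Implicit Arguments.
Unset Strict Implicit.
Unset Printing Implicit Defensive.

Import Order.TTheory GRing.Theory Num.Theory.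
Import numFieldNormedType.Exports.

Local Open Scope classical_set_scope.
Local Open Scope ring_scope.

Section PositiveDefinite.
Variable R : realType.

(* Symmetry is not part of [posdef] and [negdef]; it is required separately
   wherever the matrix is not symmetric by construction. *)
Definition posdef n (S : 'M[R]_n) : Prop :=
  forall x : 'cV[R]_n, x != 0 -> 0 < (x^T *m S *m x) 0 0.

Definition spd n (S : 'M[R]_n) : Prop := S^T = S /\ posdef S.

Definition negdef n (S : 'M[R]_n) : Prop :=
  forall x : 'cV[R]_n, x != 0 -> (x^T *m S *m x) 0 0 < 0.

End PositiveDefinite.

Section Polynomials.
Variable R : realType.

(* The n-th derivative below is divisible by 'X^k, so the division is exact. *)
Definition jacobi (k n : nat) : {poly R} :=
  (n`!%:R)^-1 *: (('X^k * ('X^2 - 'X) ^+ n)^`(n) %/ 'X^k).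

(* [q_poly k i] is x^k P_{k,i}(x), that is q_{k,k+i}. *)
Definition q_poly (k i : nat) : {poly R} := 'X^k * jacobi k i.

(* Coordinates of p in the basis P_{0,0}, ..., P_{0,M-1} of the polynomials of
   degree at most M-1; meaningful when size p <= M, see [legendre_coordP]. *)
Definition legendre_coord (M : nat) (p : {poly R}) : 'rV[R]_M :=
  get [set c : 'rV[R]_M | p = \sum_(l < M) c 0 l *: jacobi 0 l].

Lemma size_jacobi0 n : size (jacobi 0 n) = n.+1.
Proof.
have nz : (n`!%:R : R)^-1 != 0 by rewrite invr_eq0 pnatr_eq0 -lt0n fact_gt0.
rewrite /jacobi size_scale // expr0 divp1 mul1r.
have mX : ('X^2 - 'X : {poly R}) \is monic.
  by rewrite monicE lead_coefDl ?lead_coefXn // size_polyN size_polyX size_polyXn.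
have sX : size ('X^2 - 'X : {poly R}) = 3%N.
  by rewrite size_polyDl ?size_polyXn // size_polyN size_polyX.
have sXn : size (('X^2 - 'X : {poly R}) ^+ n) = (n + n).+1.
  rewrite -[LHS]prednK; last first.
    by rewrite lt0n size_poly_eq0 monic_neq0 // monic_exp.
  by rewrite size_exp sX /= mul2n addnn.
apply/eqP; rewrite eqn_leq; apply/andP; split.
  apply/leq_sizeP => j nj; rewrite coef_derivn nth_default ?mul0rn //.
  by rewrite sXn -addnS leq_add2l.
rewrite ltnNge; apply/negP => /leq_sizeP /(_ _ (leqnn _)).
rewrite coef_derivn.
have -> : (('X^2 - 'X : {poly R}) ^+ n)`_(n + n) = 1.
  by have /monicP := monic_exp n mX; rewrite lead_coefE sXn.
move/eqP; rewrite pnatr_eq0 => /eqP h.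
by have := ffact_gt0 (n + n) n; rewrite h leq_addr.
Qed.

Lemma legendre_coordP M (p : {poly R}) : (size p <= M)%N ->
  p = \sum_(l < M) legendre_coord M p 0 l *: jacobi 0 l.
Proof.
move=> sp; rewrite /legendre_coord.
apply: (@getPex _ [set c : 'rV[R]_M | p = \sum_(l < M) c 0 l *: jacobi 0 l]).
suff [c ->] : exists c : nat -> R, p = \sum_(l < M) c l *: jacobi 0 l.
  by exists (\row_l c l) => /=; apply: eq_bigr => l _; rewrite mxE.
elim: M p sp => [|M IH] p sp.
  by exists (fun=> 0); rewrite big_ord0; apply/eqP; rewrite -size_poly_leq0.
pose a := p`_M / (jacobi 0 M)`_M.
have jM : (jacobi 0 M)`_M != 0.
  have := size_jacobi0 M; have := lead_coefE (jacobi 0 M) => + sJ.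
  rewrite sJ /= => <-; by rewrite lead_coef_eq0 -size_poly_eq0 sJ.
have [|c pc] := IH (p - a *: jacobi 0 M).
  apply/leq_sizeP => j; rewrite leq_eqVlt => /predU1P[<-|Mj].
    by rewrite coefB coefZ /a divfK // subrr.
  rewrite coefB coefZ (nth_default _ (leq_trans sp Mj)).
  by rewrite nth_default ?mulr0 ?subr0 // size_jacobi0.
exists (fun l => if l == M then a else c l).
rewrite big_ord_recr /= eqxx -[LHS](subrK (a *: jacobi 0 M)) {1}pc.
by congr (_ + _); apply: eq_bigr => l _; rewrite ltn_eqF.
Qed.

Definition xi (M k i : nat) : 'rV[R]_M := legendre_coord M (q_poly k i).

Definition zeta (M k i : nat) : 'rV[R]_(1 + (1 + M)) :=
  row_mx 1%:M
    (row_mx (if k == 0%N then (-1) ^+ i.+1 else 0)%:M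
            (- legendre_coord M (q_poly k i)^`())).

Definition Xi (M : nat) (nu1 : nat -> nat) (k : nat) :
    'M[R]_((nu1 k).+1, M) := \matrix_(i < (nu1 k).+1) xi M k i.

Definition Zcal (M : nat) (nu2 : nat -> nat) (k : nat) :
    'M[R]_((nu2 k).+1, 1 + (1 + M)) := \matrix_(i < (nu2 k).+1) zeta M k i.

Definition Ltilde0 (M : nat) : 'M[R]_(M, 1 + (1 + M)) :=
  \matrix_(i < M) zeta M 0 i.

End Polynomials.

(* Kronecker products [X *t 1%:M] with the n x n identity are indexed by
   'I_(m * n), block index first; the products (1 + M) * n and (1 + (1 + M)) * n
   are convertible to n + M * n and n + (n + M * n), which is what makes the
   block constructions below agree with them. *)
Section LMI.
Variables (R : realType) (n M : nat) (tau : R).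

Definition block_row m (F : 'I_m -> 'M[R]_n) : 'M[R]_(n, m * n) :=
  \matrix_(a, b) F (mxtens_unindex b).1 a (mxtens_unindex b).2.

Definition Acal (A Ad1 Ad2 : 'M[R]_n) : 'M[R]_(n, (1 + (1 + M)) * n) :=
  row_mx A (row_mx Ad1
    (block_row (fun l : 'I_M => if l == 0%N :> nat then tau *: Ad2 else 0))).

Definition LambdaM (A Ad1 Ad2 : 'M[R]_n) :
    'M[R]_((1 + M) * n, (1 + (1 + M)) * n) :=
  col_mx (Acal A Ad1 Ad2) (Ltilde0 R M *t (1%:M : 'M[R]_n)).

Definition GammaM : 'M[R]_((1 + M) * n, (1 + (1 + M)) * n) :=
  (block_mx 1%:M           (0 : 'M[R]_(1, 1 + M))
            (0 : 'M[R]_(M, 1)) (row_mx (0 : 'M[R]_(M, 1)) tau%:M))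
  *t (1%:M : 'M[R]_n).

(* diag{(j+1) Q_k, (j+3) Q_k, ..., (j + 2 nu1_j + 1) Q_k}, a block-diagonal
   matrix with scalar multiples of one block, written as diag(c) (x) Q_k. *)
Definition Qcal (nu1 : nat -> nat) (Q : nat -> 'M[R]_n) (k j : nat) :
    'M[R]_((nu1 j).+1 * n) :=
  diag_mx (\row_(i < (nu1 j).+1) (j + 2 * i + 1)%:R) *t Q k.

(* [Rcal nu2 Rm k j] is diag{(j+1) R_k, (j+3) R_k, ..., (j + 2 nu2_j + 1) R_k};
   for k = j + 1 its coefficients are k, k + 2, ..., k + 2 nu2_{k-1}. *)
Definition Rcal (nu2 : nat -> nat) (Rm : nat -> 'M[R]_n) (k j : nat) :
    'M[R]_((nu2 j).+1 * n) :=
  diag_mx (\row_(i < (nu2 j).+1) (j + 2 * i + 1)%:R) *t Rm k.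

Definition XiI (nu1 : nat -> nat) (k : nat) : 'M[R]_((nu1 k).+1 * n, M * n) :=
  Xi R M nu1 k *t (1%:M : 'M[R]_n).

Definition ZI (nu2 : nat -> nat) (k : nat) :
    'M[R]_((nu2 k).+1 * n, (1 + (1 + M)) * n) :=
  Zcal R M nu2 k *t (1%:M : 'M[R]_n).

Definition Psi0 (m1 : nat) (nu1 : nat -> nat)
    (P : 'M[R]_((1 + M) * n)) (Q : nat -> 'M[R]_n) : 'M[R]_((1 + M) * n) :=
  tau *: P + \sum_(0 <= j < m1.+1)
    (block_mx (0 : 'M[R]_n) 0
              0 ((XiI nu1 j)^T *m Qcal nu1 Q j j *m XiI nu1 j)
     : 'M[R]_((1 + M) * n)).

Definition Psi1 (A Ad1 Ad2 : 'M[R]_n) (P : 'M[R]_((1 + M) * n)) :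
    'M[R]_((1 + (1 + M)) * n) :=
  GammaM^T *m P *m LambdaM A Ad1 Ad2 + (LambdaM A Ad1 Ad2)^T *m P *m GammaM.

Definition Psi2 (m1 : nat) (nu1 : nat -> nat) (Q : nat -> 'M[R]_n) :
    'M[R]_((1 + (1 + M)) * n) :=
  block_mx (\sum_(0 <= j < m1.+1) Q j) 0
    0 (block_mx (- Q 0%N) 0
        0 (- \sum_(1 <= j < m1.+1)
             j%:R *: ((XiI nu1 j.-1)^T *m Qcal nu1 Q j j.-1 *m XiI nu1 j.-1))).

Definition Psi31 (m2 : nat) (A Ad1 Ad2 : 'M[R]_n) (Rm : nat -> 'M[R]_n) :
    'M[R]_((1 + (1 + M)) * n) :=
  tau *: ((Acal A Ad1 Ad2)^T *m (\sum_(1 <= j < m2.+1) Rm j) *m Acal A Ad1 Ad2).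

Definition Psi32 (m2 : nat) (nu2 : nat -> nat) (Rm : nat -> 'M[R]_n) :
    'M[R]_((1 + (1 + M)) * n) :=
  tau^-1 *: \sum_(1 <= j < m2.+1)
    j%:R *: ((ZI nu2 j.-1)^T *m Rcal nu2 Rm j j.-1 *m ZI nu2 j.-1).

End LMI.

Section DelaySystem.
Variables (R : realType) (n : nat) (tau : R) (A Ad1 Ad2 : 'M[R]_n).

Definition vintegral (a b : R) (x : R -> 'cV[R]_n) : 'cV[R]_n :=
  \col_i Rintegral (@lebesgue_measure R) `[a, b] (fun s => x s i 0).

Definition delay_rhs (x : R -> 'cV[R]_n) (t : R) : 'cV[R]_n :=
  A *m x t + Ad1 *m x (t - tau) + Ad2 *m vintegral (t - tau) t x.

(* At t = 0 the derivative is the right one, as usual for functional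
   differential equations: x need not be differentiable on the left of 0. *)
Definition delay_solution (phi x : R -> 'cV[R]_n) : Prop :=
  [/\ {within `[- tau, +oo[, continuous x},
      (forall t : R, - tau <= t <= 0 -> x t = phi t),
      (forall t : R, 0 < t -> is_derive t (1 : R) x (delay_rhs x t)) &
      h^-1 *: (x h - x 0) @[h --> (0 : R)^'+] --> delay_rhs x 0].

(* The initial functions of C([-tau, 0], R^n) in the open ball of radius d
   for the supremum norm. *)
Definition initial_ball (d : R) (phi : R -> 'cV[R]_n) : Prop :=
  {within `[- tau, 0], continuous phi} /\
  forall t : R, - tau <= t <= 0 -> `|phi t| < d.

Definition delay_stable : Prop :=
  forall e : R, 0 < e -> exists2 d : R, 0 < d &
    forall phi x, initial_ball d phi -> delay_solution phi x ->
      forall t : R, 0 <= t -> `|x t| < e.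

Definition delay_attractive : Prop :=
  exists2 d : R, 0 < d &
    forall phi x, initial_ball d phi -> delay_solution phi x ->
      x t @[t --> +oo] --> (0 : 'cV[R]_n).

Definition asymptotically_stable : Prop := delay_stable /\ delay_attractive.

End DelaySystem.

(* Main.v *)
(** Let u(t, th) = x (t - tau + th tau) for th in [0, 1]. Along a solution, the
    Lyapunov-Krasovskii functional
      V(t) = eta^T P eta + sum_j int_(t-tau)^t th^j x^T Q_j x ds
                         + tau sum_j int_(t-tau)^t th^j x'^T R_j x' ds,
    where th = (s - t + tau) / tau and eta collects x(t) and the Legendre moments
    of u(t, .), has a derivative made of Psi^1, the boundary terms of Psi^2 and
    Psi^{3,1}, and integrals with weight th^(j-1). The polynomials P_(k,i) are
    orthogonal on [0, 1] for the weight th^k, with squared norm 1 / (k + 2 i + 1),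
    so Bessel's inequality bounds these integrals by the remaining terms of the
    linear matrix inequality (for x', after an integration by parts). Hence
    V >= c |x|^2 and V' <= - c |x|^2. As x' is only available for t > 0, this is
    used from t = tau on; on [0, tau] the solution is bounded by a multiple of the
    initial function by a Gronwall-type argument. Stability follows, and
    Barbalat's argument gives x(t) -> 0. *)
Require Import Defs.
From mathcomp Require Import all_boot all_order all_algebra.
From mathcomp Require Import all_classical all_reals all_analysis.
From mathcomp Require Import ring lra.

Set Implicit Arguments.
Unset Strict Implicit.
Unset Printing Implicit Defensive.

Import Order.TTheory GRing.Theory Num.Theory.
Import numFieldNormedType.Exports.

Local Open Scope classical_set_scope.
Local Open Scope ring_scope.

(** * Jacobi polynomials *)

Section Divisibility.
Variable F : fieldType.
Implicit Types p : {poly F}.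

Lemma dvdp_derivn (a : F) k i p :
  ('X - a%:P) ^+ (k + i) %| p -> ('X - a%:P) ^+ k %| p^`(i).
Proof.
elim: i k p => [|i IH] k p; first by rewrite addn0 derivn0.
rewrite addnS -addSn derivnS => /IH/dvdpP[r ->].
rewrite derivM dvdp_add //; first by rewrite dvdp_mull // dvdp_exp2l.
by rewrite dvdp_mull // deriv_exp /= -mulr_natl dvdp_mull // dvdp_mull.
Qed.

Lemma derivn_root (a : F) j i p :
  (j < i)%N -> ('X - a%:P) ^+ i %| p -> p^`(j).[a] = 0.
Proof.
move=> ji; rewrite -(subnK ji) addnS -addSn => /dvdp_derivn.
move=> /(dvdp_trans (dvdp_exp _ (dvdpp _))) => /(_ isT).
by rewrite dvdp_XsubCl => /eqP.
Qed.

(** At [a] only the Leibniz term in which all [i] derivatives fall on the power survives. The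
    induction generalizes [p], because one derivative of p (X - a)^(i+1) is (p' (X - a) + (i+1) p)
    (X - a)^i. *)
Lemma derivn_mul_expXsubC (a : F) i p :
  ((p * ('X - a%:P) ^+ i)^`(i)).[a] = i`!%:R * p.[a].
Proof.
elim: i p => [|i IH] p; first by rewrite mulr1 mul1r.
rewrite derivSn derivM deriv_exp /= derivXsubC mul1r.
rewrite mulrnAr -mulrnAl exprS mulrA -mulrDl IH.
by rewrite !hornerE hornerMn factS natrM; ring.
Qed.

Lemma derivn_size_leS i p : (size p <= i.+1)%N -> p^`(i) = (i`!%:R * p`_i)%:P.
Proof.
move=> sp; apply/polyP => j; rewrite coef_derivn coefC.
case: j => [|j]; first by rewrite addn0 ffactnn mulr_natl.
by rewrite nth_default ?mul0rn // (leq_trans sp) // addnS ltnS leq_addr.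
Qed.

End Divisibility.

Section Jacobi.
Variable R : realType.
Local Notation jacobi := (@jacobi R).
Local Notation q_poly := (@q_poly R).

(** The polynomial differentiated in Rodrigues' formula. Its factored form [rodE0] displays a zero
    of order k + i at 0 and one of order i at 1. *)
Let rod k i : {poly R} := 'X^k * ('X^2 - 'X) ^+ i.

Let rodE0 k i : rod k i = 'X^(k + i) * ('X - 1%:P) ^+ i.
Proof.
by rewrite /rod exprD -mulrA -exprMn; congr (_ * _ ^+ _); rewrite mulrBr mulr1 expr2.
Qed.

Let factR_neq0 i : (i`!%:R : R) != 0.
Proof. by rewrite pnatr_eq0 -lt0n fact_gt0. Qed.

(** The division by X^k in [jacobi] is exact: [i] derivatives lower the order k + i of the zero at 0
    by at most [i]. *)
Lemma q_polyE k i :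
  q_poly k i = (i`!%:R)^-1 *: ('X^k * ('X^2 - 'X) ^+ i)^`(i).
Proof.
rewrite /Defs.q_poly /Defs.jacobi -scalerAr mulrC divpK //.
rewrite -[X in X ^+ k %| _]subr0 -polyC0; apply: dvdp_derivn.
by rewrite -/(rod k i) rodE0 polyC0 subr0 dvdp_mulr.
Qed.

Let rod_monic k i : rod k i \is monic.
Proof. by rewrite rodE0 monicMr ?monicXn// monic_exp // monicXsubC. Qed.

Let size_rod k i : size (rod k i) = (k + i + i).+1.
Proof.
rewrite rodE0 size_monicM ?monicXn// ?monic_neq0 ?monic_exp ?monicXsubC//.
by rewrite size_polyXn size_exp_XsubC addnS.
Qed.

Lemma size_q_poly k i : (size (q_poly k i) <= (k + i).+1)%N.
Proof.
rewrite q_polyE -/(rod k i); apply: leq_trans (size_scale_leq _ _) _.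
apply/leq_sizeP => j kj; rewrite coef_derivn nth_default ?mul0rn //.
by rewrite size_rod -addSn (addnC i) leq_add2r.
Qed.

Lemma size_jacobi k i : (size (jacobi k i) <= i.+1)%N.
Proof.
have [->|nz] := eqVneq (jacobi k i) 0; first by rewrite size_poly0.
have := size_q_poly k i.
by rewrite /Defs.q_poly mulrC size_mulXn// -addnS leq_add2l.
Qed.

Lemma q_poly1 k i : (q_poly k i).[1] = 1.
Proof.
rewrite q_polyE -/(rod k i) rodE0 hornerZ derivn_mul_expXsubC hornerXn expr1n mulr1.
exact: mulVf.
Qed.

Lemma q_poly0 k i : (q_poly k i).[0] = if k == 0%N then (-1) ^+ i else 0.
Proof.
case: k => [|k] /=; last by rewrite /Defs.q_poly hornerM hornerXn exprS !mul0r.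
rewrite q_polyE -/(rod 0 i) rodE0 add0n mulrC -[X in _ * X ^+ i]subr0 -polyC0.
by rewrite hornerZ derivn_mul_expXsubC mulKf // horner_exp !hornerE.
Qed.

(** The leading coefficient is the binomial coefficient of k + 2i over i, stated without
    division. *)
Lemma jacobi_lead k i :
  i`!%:R * (k + i)`!%:R * (jacobi k i)`_i = (k + i + i)`!%:R.
Proof.
have -> : (jacobi k i)`_i = (q_poly k i)`_(k + i).
  by rewrite /Defs.q_poly coefXnM ltnNge leq_addr /= addKn.
rewrite q_polyE -/(rod k i) coefZ coef_derivn.
have -> : (rod k i)`_(i + (k + i)) = 1.
  by have /monicP := rod_monic k i; rewrite lead_coefE size_rod [(i + _)%N]addnC.
rewrite [(i + _)%N]addnC; have := @ffact_fact (k + i + i) i.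
rewrite addnK leq_addl => /(_ isT) <-; rewrite natrM.
by field; rewrite factR_neq0.
Qed.

(* [L] is integration over [0, 1]. *)
Variable L : {poly R} -> R.
Hypothesis LD : forall p q, L (p + q) = L p + L q.
Hypothesis LZ : forall c p, L (c *: p) = c * L p.
Hypothesis Lderiv : forall p, L p^`() = p.[1] - p.[0].

Let L0 : L 0 = 0.
Proof. by have := LZ 0 0; rewrite scale0r mul0r. Qed.

Let L_derivM p q : L (p^`() * q) = (p * q).[1] - (p * q).[0] - L (p * q^`()).
Proof. by rewrite -Lderiv derivM LD addrK. Qed.

(** Repeated integration by parts. Every boundary term contains a derivative of [f] of order less
    than [i], which vanishes at 0 and at 1. *)
Let L_derivnM i j f g : (j <= i)%N ->
    ('X - 0%:P) ^+ i %| f -> ('X - 1%:P) ^+ i %| f ->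
  L (f^`(j) * g) = (-1) ^+ j * L (f * g^`(j)).
Proof.
elim: j g => [|j IH] g ji f0 f1; first by rewrite mul1r.
rewrite derivnS L_derivM !hornerM !(derivn_root ji) // !mul0r subr0 sub0r.
by rewrite IH ?(ltnW ji)// -derivSn exprS mulN1r mulNr.
Qed.

(** Euler's Beta integral. Integration by parts trades one factor X - 1 for a factor X, so the
    induction on [b] is for all [a]. *)
Let L_beta a b :
  (a + b).+1`!%:R * L ('X^a * ('X - 1%:P) ^+ b) = (-1) ^+ b * a`!%:R * b`!%:R.
Proof.
elim: b a => [|b IH] a.
  rewrite mulr1 addn0 mul1r mulr1 factS natrM mulrAC -LZ scaler_nat.
  have -> : 'X^a *+ a.+1 = ('X^(a.+1) : {poly R})^`() by rewrite derivXn.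
  by rewrite Lderiv !hornerE expr1n exprS mul0r subr0 mul1r.
have aE : L ('X^a * ('X - 1%:P) ^+ b.+1) =
    - (b.+1%:R / a.+1%:R) * L ('X^(a.+1) * ('X - 1%:P) ^+ b).
  have -> : 'X^a = a.+1%:R^-1 *: ('X^(a.+1) : {poly R})^`().
    by rewrite derivXn /= -[X in _ *: X]scaler_nat scalerA mulVf ?scale1r// pnatr_eq0.
  rewrite -scalerAl LZ L_derivM deriv_exp /= derivXsubC mul1r.
  rewrite !hornerM !hornerXn horner_exp hornerXsubC subrr !expr0n mul0r mulr0 subr0 sub0r.
  by rewrite mulrnAr -[X in _ * - L X]scaler_nat LZ; ring.
rewrite aE addnS -addSn mulrCA IH exprS factS [in RHS]factS !natrM.
have : a.+1%:R != 0 :> R by rewrite pnatr_eq0.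
by move: a.+1%:R => c c0; field.
Qed.

(** By symmetry let j <= i, and move the [i] derivatives of Rodrigues' formula onto P_(k,j). They
    annihilate it if j < i; if j = i they leave i! times the leading coefficient, and a Beta
    integral remains. *)
Lemma jacobi_orthogonal k i j :
  L ('X^k * jacobi k i * jacobi k j) = (i == j)%:R / (k + 2 * i + 1)%:R.
Proof.
have h a b : (b <= a)%N ->
    L ('X^k * jacobi k a * jacobi k b) = (a == b)%:R / (k + 2 * a + 1)%:R.
  move=> ba; rewrite -/(q_poly k a) q_polyE -/(rod k a) -scalerAl LZ.
  rewrite (@L_derivnM a) //; last 2 first.
  - by rewrite rodE0 polyC0 subr0 exprD -mulrA mulrCA dvdp_mulr.
  - by rewrite rodE0 dvdp_mull.
  move: ba; rewrite leq_eqVlt => /predU1P[ba|ba].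
    subst b; rewrite eqxx derivn_size_leS ?size_jacobi// [rod k a * _]mulrC mul_polyC LZ rodE0.
    have := jacobi_lead k a; have := L_beta (k + a) a.
    have -> : (k + 2 * a + 1 = (k + a + a).+1)%N by rewrite mul2n -addnn addn1 addnA.
    rewrite factS natrM; set l := L _; set c := _`_a.
    move: (factR_neq0 a) (factR_neq0 (k + a)) (factR_neq0 (k + a + a)).
    set x := a`!%:R; set y := (k + a)`!%:R; set w := (k + a + a)`!%:R => x0 y0 w0.
    have d0 : (k + a + a).+1%:R != 0 :> R by rewrite pnatr_eq0.
    move=> hl hc; have -> : l = (-1) ^+ a * y * x / ((k + a + a).+1%:R * w).
      by rewrite -hl mulrC mulKf// mulf_neq0.
    have -> : c = w / (x * y) by rewrite -hc mulrC mulKf// mulf_neq0.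
    have s : (-1) ^+ a * (-1) ^+ a = 1 :> R by rewrite -exprMn mulrNN mulr1 expr1n.
    transitivity ((-1) ^+ a * (-1) ^+ a / (k + a + a).+1%:R : R); last by rewrite s.
    by move: d0 {s}; move: _.+1%:R ((-1) ^+ a) => d e d0; field; rewrite x0 y0 w0 d0.
  rewrite gtn_eqF // mul0r.
  have -> : (jacobi k b)^`(a) = 0.
    apply/polyP => m; rewrite coef_derivn nth_default ?mul0rn ?coef0 //.
    by rewrite (leq_trans (size_jacobi k b)) // (leq_trans ba) // leq_addr.
  by rewrite mulr0 L0 !mulr0.
have [/h //|/ltnW/h] := leqP j i.
rewrite mulrAC => ->; rewrite eq_sym; have [->|] := eqVneq i j; first by [].
by rewrite !mul0r.
Qed.

End Jacobi.

(** * Integration of continuous functions *)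

Section Continuity.
Variables (R : realType) (T : topologicalType).

Lemma continuous_mul (f g : T -> R) : continuous f -> continuous g ->
  continuous (fun s => f s * g s).
Proof. by move=> cf cg s; apply: continuousM; [exact: cf|exact: cg]. Qed.

Lemma continuous_add (f g : T -> R) : continuous f -> continuous g ->
  continuous (fun s => f s + g s).
Proof. by move=> cf cg s; apply: continuousD; [exact: cf|exact: cg]. Qed.

Lemma continuous_sumr (I : Type) (r : seq I) (P : pred I) (F : I -> T -> R) :
  (forall i, P i -> continuous (F i)) ->
  continuous (fun s => \sum_(i <- r | P i) F i s).
Proof.
move=> cF; elim: r => [|i r IH].
  have -> : (fun s => \sum_(i <- [::] | P i) F i s) = fun=> 0.
    by apply/funext => s; rewrite big_nil.
  exact: cst_continuous.
have -> : (fun s => \sum_(i <- i :: r | P i) F i s) =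
    fun s => if P i then F i s + \sum_(i <- r | P i) F i s
             else \sum_(i <- r | P i) F i s.
  by apply/funext => s; rewrite big_cons.
case Pi: (P i); last exact: IH.
move=> s.
by apply: continuousD; [exact: cF|exact: IH].
Qed.

End Continuity.

Section Primitives.
Variable R : realType.
Implicit Types (f g F G : R -> R) (a b c s t : R).
Local Notation mu := (@lebesgue_measure R).

(** Two-sided differentiability on the whole line is demanded, so that no endpoint conditions arise
    in the calculus below. *)
Definition is_primitive F f := forall t, is_derive t (1 : R) F (f t).

Lemma is_primitive_cst c : is_primitive (fun=> c) (fun=> 0).
Proof. by move=> t; exact: is_derive_cst. Qed.

Lemma is_primitiveD F G f g : is_primitive F f -> is_primitive G g ->
  is_primitive (fun t => F t + G t) (fun t => f t + g t).
Proof. by move=> Ff Gg t; apply: is_deriveD. Qed.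

Lemma is_primitiveB F G f g : is_primitive F f -> is_primitive G g ->
  is_primitive (fun t => F t - G t) (fun t => f t - g t).
Proof. by move=> Ff Gg t; apply: is_deriveB. Qed.

Lemma is_primitiveZ c F f : is_primitive F f ->
  is_primitive (fun t => c * F t) (fun t => c * f t).
Proof. by move=> Ff t; apply: is_deriveZ. Qed.

Lemma is_primitiveM F G f g : is_primitive F f -> is_primitive G g ->
  is_primitive (fun t => F t * G t) (fun t => f t * G t + F t * g t).
Proof.
move=> Ff Gg t; have := is_deriveM (Ff t) (Gg t).
by rewrite addrC [_ *: f t]mulrC.
Qed.

Lemma is_primitive_sum (I : Type) (r : seq I) (P : pred I) (F f : I -> R -> R) :
  (forall i, P i -> is_primitive (F i) (f i)) ->
  is_primitive (fun t => \sum_(i <- r | P i) F i t)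
               (fun t => \sum_(i <- r | P i) f i t).
Proof.
move=> Ff; elim: r => [|i r IH] t.
  rewrite big_nil; have -> : (fun t => \sum_(i <- [::] | P i) F i t) = fun=> 0.
    by apply/funext => s; rewrite big_nil.
  exact: is_primitive_cst.
have -> : (fun s => \sum_(i <- i :: r | P i) F i s) =
    fun s => if P i then F i s + \sum_(i <- r | P i) F i s
             else \sum_(i <- r | P i) F i s.
  by apply/funext => s; rewrite big_cons.
rewrite big_cons; case Pi: (P i); last exact: IH.
exact: (is_primitiveD (Ff i Pi) IH).
Qed.

Lemma is_primitive_shift F f c : is_primitive F f ->
  is_primitive (fun t => F (t - c)) (fun t => f (t - c)).
Proof.
move=> Ff t; have id1 : is_primitive id (fun=> 1) by move=> s; exact: is_derive_id.
have := is_primitiveB id1 (is_primitive_cst c) t; rewrite subr0 => dt.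
rewrite -[f (t - c)]mulr1.
exact: (@is_derive1_comp _ F (fun s => s - c) t (f (t - c)) 1 (Ff (t - c)) dt).
Qed.

Lemma is_primitive_continuous F f : is_primitive F f -> continuous F.
Proof.
move=> Ff t; apply: differentiable_continuous; apply/derivable1_diffP.
by case: (Ff t).
Qed.

Lemma is_primitive_MVT F f a b : is_primitive F f -> a <= b ->
  exists2 c, a <= c <= b & F b - F a = f c * (b - a).
Proof.
move=> Ff ab; have [c cab ->] : exists2 c, c \in `[a, b] & F b - F a = f c * (b - a).
  apply: MVT_segment => //; apply: continuous_subspaceT.
  exact: is_primitive_continuous Ff.
by exists c => //; rewrite in_itv in cab.
Qed.

Lemma is_primitive_unique F G f a b :
  is_primitive F f -> is_primitive G f -> F b - F a = G b - G a.
Proof.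
wlog ab : a b / a <= b => [h|] Ff Gf.
  have [/h|/ltW/h] := leP a b; first exact.
  by move=> /(_ Ff Gf) /(congr1 -%R); rewrite !opprB.
have Hf : is_primitive (fun t => F t - G t) (fun=> 0).
  by move=> t; rewrite -(subrr (f t)); exact: is_primitiveB.
have [c _] := is_primitive_MVT Hf ab; rewrite mul0r; lra.
Qed.

Lemma continuous_itv_integrable f a b :
  continuous f -> mu.-integrable `[a, b] (EFin \o f).
Proof.
move=> cf; apply: continuous_compact_integrable; first exact: segment_compact.
exact: continuous_subspaceT.
Qed.

Let Rint_itvB f c s t : continuous f -> c <= s -> s <= t ->
  Rintegral mu `[c, t] f - Rintegral mu `[c, s] f = Rintegral mu `[s, t] f.
Proof.
move=> cf cs st; rewrite Rintegral_itvB ?bnd_simp//; last exact: continuous_itv_integrable.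
apply: Rintegral_itv_obnd_cbnd; apply: integrableS (continuous_itv_integrable s t cf) => //.
by apply: subset_itvr; rewrite bnd_simp.
Qed.

(* For [t <> 0] exactly one of the two intervals is empty. *)
Definition primitive f t := Rintegral mu `[0, t] f - Rintegral mu `[t, 0] f.

(** A base point to the left of both 0 and [t] removes the case distinction on the sign of [t], so
    the fundamental theorem of calculus applies around [t]. *)
Let primitiveE f c t : continuous f -> c <= 0 -> c <= t ->
  primitive f t = Rintegral mu `[c, t] f - Rintegral mu `[c, 0] f.
Proof.
move=> cf c0 ct; rewrite /primitive; have [t0|t0] := leP 0 t.
  rewrite (Rint_itvB cf c0 t0); suff -> : Rintegral mu `[t, 0] f = 0 by rewrite subr0.
  move: t0; rewrite le_eqVlt => /predU1P[<-|t0].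
    by rewrite -(@Rint_itvB f 0 0 0)// subrr.
  by rewrite set_itv_ge ?Rintegral_set0// bnd_simp -ltNge.
rewrite -[RHS]opprB (Rint_itvB cf ct (ltW t0)) set_itv_ge ?Rintegral_set0 ?sub0r//.
by rewrite bnd_simp -ltNge.
Qed.

Lemma primitiveP f : continuous f -> is_primitive (primitive f) f.
Proof.
move=> cf t; pose c := Num.min 0 t - 1.
have [c0 ct] : c <= 0 /\ c < t.
  have := ge_min 0 0 t; have := ge_min t 0 t; rewrite !lexx orbT /= /c.
  by move=> h1 h2; split; lra.
pose F s := Rintegral mu `[c, s] f.
have [dF F'] : derivable F t 1 /\ derive1 F t = f t.
  apply: (@continuous_FTC1_closed _ f c t (t + 1)) => //; first lra.
  - exact: continuous_itv_integrable.
  - exact: cf.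
apply: (@near_eq_is_derive _ _ _ (fun s => F s - Rintegral mu `[c, 0] f)).
  near=> s; rewrite (primitiveE cf c0)//.
  by apply: ltW; near: s; exact: lt_nbhsr.
rewrite -[f t]subr0; apply: is_deriveB; rewrite -F' derive1E; exact: DeriveDef.
Unshelve. all: by end_near. Qed.

(** As an increment of a primitive, the integral makes sense for b < a too, and its algebraic rules
    reduce by [rintE] to exhibiting a primitive. *)
Definition rint a b f := primitive f b - primitive f a.

Lemma rint_Rintegral f a b : continuous f -> a <= b -> Rintegral mu `[a, b] f = rint a b f.
Proof.
move=> cf ab; pose c := Num.min 0 a.
have [c0 ca] : c <= 0 /\ c <= a by rewrite !ge_min !lexx orbT.
rewrite /rint !(@primitiveE f c)// ?(le_trans ca)// -(@Rint_itvB f c)//; lra.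
Qed.

Lemma rintE F f a b : continuous f -> is_primitive F f -> rint a b f = F b - F a.
Proof. by move=> cf Ff; apply: is_primitive_unique Ff; apply: primitiveP. Qed.

Lemma rintD f g a b : continuous f -> continuous g ->
  rint a b (fun s => f s + g s) = rint a b f + rint a b g.
Proof.
move=> cf cg; rewrite (@rintE (fun s => primitive f s + primitive g s)).
- by rewrite /rint; ring.
- by move=> t; apply: continuousD; [exact: cf|exact: cg].
- by apply: is_primitiveD; exact: primitiveP.
Qed.

Lemma rintZ f c a b : continuous f -> rint a b (fun s => c * f s) = c * rint a b f.
Proof.
move=> cf; rewrite (@rintE (fun s => c * primitive f s)).
- by rewrite /rint /=; ring.
- by apply: continuous_mul => //; exact: cst_continuous.
- by apply: is_primitiveZ; exact: primitiveP.
Qed.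

Lemma rint_sum (I : Type) (r : seq I) (P : pred I) (F : I -> R -> R) a b :
  (forall i, P i -> continuous (F i)) ->
  rint a b (fun s => \sum_(i <- r | P i) F i s) = \sum_(i <- r | P i) rint a b (F i).
Proof.
move=> cF; rewrite (@rintE (fun t => \sum_(i <- r | P i) primitive (F i) t)).
- by rewrite -sumrB.
- exact: continuous_sumr.
- by apply: is_primitive_sum => i Pi; apply: primitiveP; exact: cF.
Qed.

Lemma rint_ge0 f a b : continuous f -> a <= b ->
  (forall s, a <= s <= b -> 0 <= f s) -> 0 <= rint a b f.
Proof.
move=> cf ab f0; have [c cab] := is_primitive_MVT (primitiveP cf) ab.
by rewrite /rint => ->; rewrite mulr_ge0 ?f0// subr_ge0.
Qed.

End Primitives.

(** * Polynomial moments over the sliding window [t - tau, t] *)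

Section Moments.
Variables (R : realType) (tau : R).
Hypothesis tau_gt0 : 0 < tau.
Implicit Types (p q : {poly R}) (f g G : R -> R) (t : R).

Let tau_neq0 : tau != 0. Proof. by rewrite gt_eqF. Qed.

(* [theta t] maps [t - tau, t] onto [0, 1]. *)
Definition theta t : {poly R} := tau^-1 *: ('X - (t - tau)%:P).

(** The integration variable is [s] and not [theta], so a moment is [tau] times the corresponding
    integral over [0, 1]; this is the source of the powers of [tau] below. *)
Definition mom p g t := rint (t - tau) t (fun s => (p \Po theta t).[s] * g s).

Let continuous_integrand p g t : continuous g ->
  continuous (fun s => (p \Po theta t).[s] * g s).
Proof. by move=> cg; apply: continuous_mul => //; exact: continuous_horner. Qed.

Let theta1 t : (theta t).[t] = 1.
Proof. by rewrite /theta !hornerE; field. Qed.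

Let theta0 t : (theta t).[t - tau] = 0.
Proof. by rewrite /theta !hornerE; field. Qed.

Lemma momDl p q g t : continuous g -> mom (p + q) g t = mom p g t + mom q g t.
Proof.
move=> cg; rewrite /mom -rintD; try exact: continuous_integrand.
by congr rint; apply/funext => s; rewrite comp_polyD hornerD mulrDl.
Qed.

Lemma momZl c p g t : continuous g -> mom (c *: p) g t = c * mom p g t.
Proof.
move=> cg; rewrite /mom -rintZ; last exact: continuous_integrand.
by congr rint; apply/funext => s; rewrite comp_polyZ hornerZ mulrA.
Qed.

Lemma mom_suml (I : Type) (r : seq I) (P : pred I) (F : I -> {poly R}) g t :
  continuous g ->
  mom (\sum_(i <- r | P i) F i) g t = \sum_(i <- r | P i) mom (F i) g t.
Proof.
move=> cg; apply: (big_morph (fun p => mom p g t)) => [p q|]; first exact: momDl.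
by rewrite -(scale0r 0) momZl// mul0r.
Qed.

Lemma momDr p f g t : continuous f -> continuous g ->
  mom p (fun s => f s + g s) t = mom p f t + mom p g t.
Proof.
move=> cf cg; rewrite /mom -rintD; try exact: continuous_integrand.
by congr rint; apply/funext => s; rewrite mulrDr.
Qed.

Lemma momZr c p g t : continuous g -> mom p (fun s => c * g s) t = c * mom p g t.
Proof.
move=> cg; rewrite /mom -rintZ; last exact: continuous_integrand.
by congr rint; apply/funext => s; rewrite mulrCA.
Qed.

Lemma mom_sumr p (I : Type) (r : seq I) (P : pred I) (F : I -> R -> R) t :
  (forall i, P i -> continuous (F i)) ->
  mom p (fun s => \sum_(i <- r | P i) F i s) t = \sum_(i <- r | P i) mom p (F i) t.
Proof.
move=> cF; elim: r => [|i r IH].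
  have -> : (fun s => \sum_(i <- [::] | P i) F i s) = fun s => 0 * cst 0 s.
    by apply/funext => s; rewrite big_nil mul0r.
  by rewrite big_nil momZr ?mul0r// => s; exact: cvg_cst.
have -> : (fun s => \sum_(i <- i :: r | P i) F i s) =
    fun s => if P i then F i s + \sum_(i <- r | P i) F i s
             else \sum_(i <- r | P i) F i s.
  by apply/funext => s; rewrite big_cons.
rewrite big_cons; case Pi: (P i); last exact: IH.
by rewrite momDr ?IH//; [exact: cF|exact: continuous_sumr].
Qed.

(** Integration by parts in [s]: [theta t] has slope 1 / tau and takes the values 1 and 0 at the
    ends of the window. *)
Lemma mom_IBP p g G t : continuous g -> is_primitive G g ->
  mom p g t = p.[1] * G t - p.[0] * G (t - tau) - tau^-1 * mom p^`() G t.
Proof.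
move=> cg Gg; have cG := is_primitive_continuous Gg.
pose h s := (p^`() \Po theta t).[s] * G s.
pose H s := (p \Po theta t).[s] * G s - tau^-1 * primitive h s.
rewrite /mom (@rintE _ H).
- by rewrite /H !horner_comp theta1 theta0 /rint /h; ring.
- exact: continuous_integrand.
move=> s; have ch : continuous h by exact: continuous_integrand.
have -> : (p \Po theta t).[s] * g s =
    ((p \Po theta t)^`().[s] * G s + (p \Po theta t).[s] * g s) - tau^-1 * h s.
  rewrite deriv_comp /theta derivZ derivB derivX derivC subr0 alg_polyC.
  by rewrite hornerM hornerC /h /=; ring.
exact: (is_primitiveB (is_primitiveM (is_derive_poly _) Gg)
  (is_primitiveZ _ (primitiveP ch))).
Qed.

(** Both the window and the weight move with [t]. Instead of differentiating under the integral
    sign, integrate by parts against a primitive of [g]: this leaves a moment with weight p', so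
    induction on the size of [p] applies. *)
Lemma is_primitive_mom p g : continuous g ->
  is_primitive (mom p g)
    (fun t => p.[1] * g t - p.[0] * g (t - tau) - tau^-1 * mom p^`() g t).
Proof.
have [n] := ubnP (size p); elim: n => // n IH in p g *; rewrite ltnS => sp cg.
have Gg := primitiveP cg; have cG := is_primitive_continuous Gg.
have -> : mom p g = fun t => p.[1] * primitive g t - p.[0] * primitive g (t - tau)
    - tau^-1 * mom p^`() (primitive g) t.
  by apply/funext => t; exact: mom_IBP.
have pG : is_primitive (mom p^`() (primitive g))
    (fun t => p^`().[1] * primitive g t - p^`().[0] * primitive g (t - tau)
              - tau^-1 * mom p^`()^`() (primitive g) t).
  (* The size drops strictly only if [p] is not constant; for constant [p] the remaining moments
     vanish. *)
  have [p0|p0] := eqVneq p^`() 0; last first.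
    apply: IH => //; apply: leq_trans (lt_size_deriv _) sp.
    by apply: contraNneq p0 => ->; rewrite derivC.
  have z f : mom 0 f = fun=> 0.
    apply/funext => s; rewrite /mom.
    rewrite (_ : (fun s0 => _) = fun=> 0) ?(@rintE _ (fun=> 0)) ?subrr//.
    - by move=> ?; exact: cvg_cst.
    - exact: is_primitive_cst.
    - by apply/funext => s0; rewrite comp_poly0 horner0 mul0r.
  rewrite p0 derivC !z => t /=; rewrite !horner0 !mul0r mulr0 !subr0.
  exact: is_derive_cst.
(* A second integration by parts, now in the claimed derivative, produces exactly the derivative
   recorded in [pG]. *)
move=> t; rewrite [mom p^`() g t](mom_IBP _ _ cg Gg).
exact: (is_primitiveB (is_primitiveB (is_primitiveZ _ Gg)
  (is_primitiveZ _ (is_primitive_shift tau Gg))) (is_primitiveZ _ pG)).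
Qed.

(** Integration by parts with the primitive 1 of the function 0. It shows that [mom] against 1,
    divided by [tau], obeys the fundamental theorem of calculus on [0, 1]. *)
Lemma mom_cst1 p t : mom p^`() (fun=> 1) t = tau * (p.[1] - p.[0]).
Proof.
have c1 : continuous (fun _ : R => 1 : R) by move=> ?; exact: cvg_cst.
have c0 : continuous (fun _ : R => 0 : R) by move=> ?; exact: cvg_cst.
have := @mom_IBP p (fun=> 0) (fun=> 1) t c0 (is_primitive_cst 1).
have -> : mom p (fun=> 0) t = 0.
  have -> : (fun=> 0 : R) = (fun s : R => 0 * (fun=> 1 : R) s) :> (R -> R).
    by apply/funext => s; rewrite mul0r.
  by rewrite momZr// mul0r.
set m := mom _ _ _ => /(congr1 ( *%R tau)).
by rewrite mulr0 mulrBr mulrA mulfV// mul1r !mulr1; lra.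
Qed.

Lemma mom_jacobi k i j t :
  mom ('X^k * jacobi R k i * jacobi R k j) (fun=> 1) t =
  tau * ((i == j)%:R / (k + 2 * i + 1)%:R).
Proof.
have c1 : continuous (fun _ : R => 1 : R) by move=> ?; exact: cvg_cst.
(* This functional meets the three axioms under which orthogonality was proved. *)
pose L p := tau^-1 * mom p (fun=> 1) t.
have LD p q : L (p + q) = L p + L q by rewrite /L momDl// mulrDr.
have LZ c p : L (c *: p) = c * L p by rewrite /L momZl// mulrCA.
have Ld p : L p^`() = p.[1] - p.[0] by rewrite /L mom_cst1 mulKf.
by rewrite -(jacobi_orthogonal LD LZ Ld) /L mulVKf.
Qed.

Lemma mom_ge0 k g t : continuous g -> (forall s, 0 <= g s) -> 0 <= mom 'X^k g t.
Proof.
move=> cg g0; apply: rint_ge0; first exact: continuous_integrand.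
  by rewrite gerBl ltW.
move=> s /andP[ts _]; rewrite mulr_ge0// comp_Xn_poly horner_exp exprn_ge0//.
by rewrite /theta !hornerE mulr_ge0 ?invr_ge0 ?(ltW tau_gt0)// subr_ge0.
Qed.

Lemma normr_rint f a b B : continuous f -> a <= b ->
  (forall s, a <= s <= b -> `|f s| <= B) -> `|rint a b f| <= B * (b - a).
Proof.
move=> cf ab fB; have [c cab] := is_primitive_MVT (primitiveP cf) ab.
rewrite /rint => ->; rewrite normrM [`|b - a|]ger0_norm ?subr_ge0//.
by apply: ler_wpM2r; rewrite ?subr_ge0// fB.
Qed.

(** On the window [theta t] lies in [0, 1], where a polynomial is at most the sum of the absolute
    values of its coefficients. *)
Lemma normr_mom p g t B : continuous g ->
  (forall s, t - tau <= s <= t -> `|g s| <= B) ->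
  `|mom p g t| <= (\sum_(i < size p) `|p`_i|) * B * tau.
Proof.
move=> cg gB; have tt : t - tau <= t by rewrite gerBl ltW.
rewrite [X in _ <= _ * X](_ : tau = t - (t - tau)); last ring.
apply: normr_rint => //; first exact: continuous_integrand.
move=> s st; rewrite normrM ler_pM ?gB// horner_comp horner_coef.
apply: le_trans (ler_norm_sum _ _ _) _; apply: ler_sum => i _.
rewrite normrM ler_piMr// normrX exprn_ile1//.
have /andP[ts1 ts2] := st; rewrite /theta !hornerE ger0_norm.
  by rewrite ler_pdivrMl// mulr1; lra.
by rewrite mulr_ge0 ?invr_ge0 ?(ltW tau_gt0)//; lra.
Qed.


End Moments.

(** * Quadratic forms and Kronecker products *)

Section MatrixNorm.
Variable R : realType.

Lemma normr_entry_le m n (x : 'M[R]_(m, n)) i j : `|x i j| <= `|x|.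
Proof.
rewrite [leRHS]mx_normrE.
by apply: (le_bigmax _ (fun ij : 'I_m * 'I_n => `|x ij.1 ij.2|) (i, j)).
Qed.

Lemma mx_norm_le m n (x : 'M[R]_(m, n)) B : 0 <= B ->
  (forall i j, `|x i j| <= B) -> `|x| <= B.
Proof. by move=> B0 xB; rewrite [leLHS]mx_normrE; apply: bigmax_le. Qed.

Lemma mx_norm_lt m n (x : 'M[R]_(m, n)) B : 0 < B ->
  (forall i j, `|x i j| < B) -> `|x| < B.
Proof. by move=> B0 xB; rewrite [ltLHS]mx_normrE; apply: bigmax_lt. Qed.

End MatrixNorm.

Section BilinearForm.
Variable R : realType.

Definition bf n (Q : 'M[R]_n) (u v : 'cV[R]_n) : R := (u^T *m Q *m v) 0 0.

Lemma bfE n (Q : 'M[R]_n) u v :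
  bf Q u v = \sum_a \sum_b Q a b * (u a 0 * v b 0).
Proof.
rewrite /bf mxE exchange_big; apply: eq_bigr => b _.
rewrite mxE mulr_suml; apply: eq_bigr => a _; rewrite mxE; ring.
Qed.

Section Fixed.
Variables (n : nat) (Q : 'M[R]_n).
Implicit Types u v w : 'cV[R]_n.

Lemma bfDl u v w : bf Q (u + v) w = bf Q u w + bf Q v w.
Proof. by rewrite /bf linearD /= !mulmxDl mxE. Qed.

Lemma bfDr u v w : bf Q w (u + v) = bf Q w u + bf Q w v.
Proof. by rewrite /bf mulmxDr mxE. Qed.

Lemma bfZl c u v : bf Q (c *: u) v = c * bf Q u v.
Proof. by rewrite /bf linearZ /= -!scalemxAl mxE. Qed.

Lemma bfZr c u v : bf Q u (c *: v) = c * bf Q u v.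
Proof. by rewrite /bf -scalemxAr mxE. Qed.

Lemma bf0l v : bf Q 0 v = 0.
Proof. by rewrite -(scale0r 0) bfZl mul0r. Qed.

Lemma bf0r v : bf Q v 0 = 0.
Proof. by rewrite -(scale0r 0) bfZr mul0r. Qed.

Lemma bf_suml I (r : seq I) (F : I -> 'cV[R]_n) v :
  bf Q (\sum_(i <- r) F i) v = \sum_(i <- r) bf Q (F i) v.
Proof. by apply: (big_morph (fun u => bf Q u v)) => [u w|]; rewrite (bfDl, bf0l). Qed.

Lemma bf_sumr I (r : seq I) (F : I -> 'cV[R]_n) v :
  bf Q v (\sum_(i <- r) F i) = \sum_(i <- r) bf Q v (F i).
Proof. by apply: (big_morph (fun u => bf Q v u)) => [u w|]; rewrite (bfDr, bf0r). Qed.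

Lemma bfC u v : Q^T = Q -> bf Q u v = bf Q v u.
Proof.
move=> Qs; rewrite /bf (_ : _ 0 0 = (u^T *m Q *m v)^T 0 0); last by rewrite [RHS]mxE.
by rewrite !trmx_mul trmxK Qs mulmxA.
Qed.

Lemma spd_ge0 u : spd Q -> 0 <= bf Q u u.
Proof. by move=> [_ Qp]; have [->|/Qp/ltW//] := eqVneq u 0; rewrite bf0l. Qed.

Lemma normr_bf_le u B : (forall i, `|u i 0| <= B) ->
  `|bf Q u u| <= (\sum_a \sum_b `|Q a b|) * B ^+ 2.
Proof.
move=> uB; rewrite bfE mulr_suml; apply: le_trans (ler_norm_sum _ _ _) _.
apply: ler_sum => a _; rewrite mulr_suml; apply: le_trans (ler_norm_sum _ _ _) _.
by apply: ler_sum => b _; rewrite !normrM ler_wpM2l// expr2 ler_pM.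
Qed.

End Fixed.

Lemma bfDm n (Q S : 'M[R]_n) u v : bf (Q + S) u v = bf Q u v + bf S u v.
Proof. by rewrite /bf mulmxDr mulmxDl mxE. Qed.

Lemma bfZm n c (Q : 'M[R]_n) u v : bf (c *: Q) u v = c * bf Q u v.
Proof. by rewrite /bf -scalemxAr -scalemxAl mxE. Qed.

Lemma bf0m n u v : bf (0 : 'M[R]_n) u v = 0.
Proof. by rewrite /bf mulmx0 mul0mx mxE. Qed.

Lemma bfNm n (Q : 'M[R]_n) u v : bf (- Q) u v = - bf Q u v.
Proof. by rewrite -scaleN1r bfZm mulN1r. Qed.

Lemma bf_summ n I (r : seq I) P (F : I -> 'M[R]_n) u v :
  bf (\sum_(i <- r | P i) F i) u v = \sum_(i <- r | P i) bf (F i) u v.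
Proof. by apply: (big_morph (fun Q => bf Q u v)) => [Q S|]; rewrite (bfDm, bf0m). Qed.

Lemma bf_mul m n (S : 'M[R]_(m, n)) (Q : 'M[R]_m) (T : 'M[R]_(m, n)) u v :
  bf (S^T *m Q *m T) u v = bf Q (S *m u) (T *m v).
Proof. by rewrite /bf trmx_mul !mulmxA. Qed.

Lemma bf_block_diag m n (A : 'M[R]_m) (D : 'M[R]_n) u v x y :
  bf (block_mx A 0 0 D) (col_mx u x) (col_mx v y) = bf A u v + bf D x y.
Proof.
by rewrite /bf tr_col_mx mul_row_block mul_row_col !mulmx0 addr0 add0r mxE.
Qed.

(** The form attains a positive minimum on the compact unit sphere of the supremum norm, and
    homogeneity carries the bound to all vectors. Entries are dominated by that norm. *)
Lemma posdef_lower_bound n (Q : 'M[R]_n) : posdef Q ->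
  exists2 c : R, 0 < c & forall (u : 'cV[R]_n) i, c * u i 0 ^+ 2 <= bf Q u u.
Proof.
move=> Qp; pose f (r : 'rV[R]_n) := bf Q r^T r^T.
pose S := [set r : 'rV[R]_n | `|r| = 1].
(* An empty sphere means dimension 0: normalizing a nonzero vector would give a point of it. *)
have [S0|/set0P S0] := eqVneq S set0.
  exists 1 => // u i; have [->|u0] := eqVneq u 0.
    by rewrite bf0l mxE expr0n mulr0.
  have : S (`|u^T|^-1 *: u^T).
    by rewrite /S /= normrZ normfV normr_id mulVf// normr_eq0 trmx_eq0.
  by rewrite S0.
have cS : compact S.
  apply: bounded_closed_compact.
    exists 1; split; first exact: num_real.
    by move=> M M1 r /= ->; exact: ltW.
  apply: (@closed_comp _ _ (fun r : 'rV[R]_n => `|r|) [set 1]).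
    by move=> r _; exact: norm_continuous.
  exact: closed_eq.
have cf : continuous f.
  have -> : f = fun r => \sum_a \sum_b Q a b * (r 0 a * r 0 b).
    apply/funext => r; rewrite /f bfE; apply: eq_bigr => a _; apply: eq_bigr => b _.
    by rewrite !mxE.
  apply: continuous_sumr => a _; apply: continuous_sumr => b _.
  apply: continuous_mul; first exact: cst_continuous.
  by apply: continuous_mul; exact: coord_continuous.
have [r0 r0S r0min] := EVT_min_rV S0 cS (continuous_subspaceT cf).
have f0 : 0 < f r0.
  apply: Qp; rewrite trmx_eq0 -normr_eq0.
  by move: r0S; rewrite inE /S /= => ->; rewrite oner_eq0.
exists (f r0) => // u i; have [->|u0] := eqVneq u 0.
  by rewrite bf0l mxE expr0n mulr0.
have nu0 : 0 < `|u^T| by rewrite normr_gt0 trmx_eq0.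
have := r0min (`|u^T|^-1 *: u^T); rewrite inE /S /= normrZ normfV normr_id.
rewrite mulVf ?gt_eqF// => /(_ erefl).
rewrite {2}/f linearZ /= trmxK bfZl bfZr mulrA -expr2 -ler_pdivrMl ?exprn_gt0 ?invr_gt0//.
rewrite -exprVn invrK mulrC; apply: le_trans; rewrite ler_pM2l//.
rewrite -real_normK ?num_real// lerXn2r ?nnegrE//.
by have := normr_entry_le u^T 0 i; rewrite mxE.
Qed.

End BilinearForm.

Section Blocks.
Variable R : realType.

Definition block_vec m n (v : 'cV[R]_(m * n)) (i : 'I_m) : 'cV[R]_n :=
  \col_a v (mxtens_index (i, a)) 0.

Definition stack m n (F : 'I_m -> 'cV[R]_n) : 'cV[R]_(m * n) :=
  \col_k F (mxtens_unindex k).1 (mxtens_unindex k).2 0.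

Lemma stackK m n (F : 'I_m -> 'cV[R]_n) i : block_vec (stack F) i = F i.
Proof. by apply/colP => a; rewrite !mxE mxtens_indexK. Qed.

Lemma block_vecP m n (u v : 'cV[R]_(m * n)) :
  (forall i, block_vec u i = block_vec v i) -> u = v.
Proof.
move=> uv; apply/colP => k; have [i a] := mxtens_indexP k.
by have /colP/(_ a) := uv i; rewrite !mxE.
Qed.

Lemma sum_mxtens m n (F : 'I_(m * n) -> R) :
  \sum_k F k = \sum_i \sum_a F (mxtens_index (i, a)).
Proof.
have bij : bijective (@mxtens_index m n).
  by exists (@mxtens_unindex m n); [exact: mxtens_indexK|exact: mxtens_unindexK].
rewrite (reindex _ (onW_bij _ bij)) (pair_bigA _ (fun i a => F (mxtens_index (i, a)))).
by apply: eq_bigr => -[].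
Qed.

Lemma block_vec_tens m p n (X : 'M[R]_(m, p)) (v : 'cV[R]_(p * n)) i :
  block_vec ((X *t (1%:M : 'M[R]_n)) *m v) i = \sum_j X i j *: block_vec v j.
Proof.
apply/colP => a; rewrite !mxE sum_mxtens summxE; apply: eq_bigr => j _.
rewrite !mxE (bigD1 a)//= tensmxE mxE eqxx mulr1 big1 ?addr0// => b ba.
by rewrite tensmxE mxE eq_sym (negPf ba) mulr0 mul0r.
Qed.

Lemma bf_diag_tens m n (c : 'rV[R]_m) (Q : 'M[R]_n) (v : 'cV[R]_(m * n)) :
  bf (diag_mx c *t Q) v v = \sum_i c 0 i * bf Q (block_vec v i) (block_vec v i).
Proof.
rewrite bfE sum_mxtens; apply: eq_bigr => i _; rewrite bfE mulr_sumr.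
apply: eq_bigr => a _; rewrite sum_mxtens (bigD1 i)//= [X in _ + X]big1 ?addr0.
  by rewrite mulr_sumr; apply: eq_bigr => b _; rewrite tensmxE !mxE eqxx mulr1n; ring.
move=> j ji; apply: big1 => b _.
by rewrite tensmxE mxE eq_sym (negPf ji) mulr0n mul0r mul0r.
Qed.

(** [(1 + m) * n] and [n + m * n] are convertible, so the type cast is silent; the two ways of
    indexing agree because the underlying natural numbers do. *)
Lemma block_vec_head m n (x : 'cV[R]_n) (y : 'cV[R]_(m * n)) :
  block_vec (col_mx x y : 'cV[R]_((1 + m) * n)) (lshift m (ord0 : 'I_1)) = x.
Proof.
apply/colP => a; rewrite mxE.
have -> : mxtens_index (lshift m (ord0 : 'I_1), a) =
    (lshift (m * n) a : 'I_((1 + m) * n)) by exact: val_inj.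
by rewrite col_mxEu.
Qed.

Lemma block_vec_tail m n (x : 'cV[R]_n) (y : 'cV[R]_(m * n)) i :
  block_vec (col_mx x y : 'cV[R]_((1 + m) * n)) (rshift 1 i) = block_vec y i.
Proof.
apply/colP => a; rewrite [LHS]mxE [RHS]mxE.
have -> : mxtens_index (rshift 1 i, a) =
    (rshift n (mxtens_index (i, a)) : 'I_((1 + m) * n)).
  by apply: val_inj; rewrite /= mulSn addnA.
by rewrite col_mxEd.
Qed.

Lemma block_row_mul m n (F : 'I_m -> 'M[R]_n) (v : 'cV[R]_(m * n)) :
  block_row F *m v = \sum_i F i *m block_vec v i.
Proof.
apply/colP => a; rewrite !mxE sum_mxtens summxE; apply: eq_bigr => i _.
by rewrite mxE; apply: eq_bigr => b _; rewrite !mxE mxtens_indexK.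
Qed.

End Blocks.

(** * Vector-valued moments and Bessel's inequality *)

Section Bessel.
Variables (R : realType) (tau : R) (n : nat).
Hypothesis tau_gt0 : 0 < tau.
Implicit Types (u z v : R -> 'cV[R]_n) (t : R) (p : {poly R}).

Definition vcontinuous m (u : R -> 'cV[R]_m) := forall a, continuous (fun s => u s a 0).

Definition is_vprimitive m (z v : R -> 'cV[R]_m) :=
  forall a, is_primitive (fun s => z s a 0) (fun s => v s a 0).

Lemma is_vprimitive_continuous m (z v : R -> 'cV[R]_m) :
  is_vprimitive z v -> vcontinuous z.
Proof. by move=> zv a; exact: is_primitive_continuous (zv a). Qed.

Lemma continuous_bf m (Q : 'M[R]_m) (u w : R -> 'cV[R]_m) :
  vcontinuous u -> vcontinuous w -> continuous (fun s => bf Q (u s) (w s)).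
Proof.
move=> cu cw; under eq_fun do rewrite bfE.
apply: continuous_sumr => a _; apply: continuous_sumr => b _.
apply: continuous_mul; first exact: cst_continuous.
exact: continuous_mul.
Qed.

Lemma is_primitive_bf m (Q : 'M[R]_m) (z v : R -> 'cV[R]_m) : is_vprimitive z v ->
  is_primitive (fun t => bf Q (z t) (z t)) (fun t => bf Q (v t) (z t) + bf Q (z t) (v t)).
Proof.
move=> zv t; have := is_primitive_sum (index_enum 'I_m) (P := xpredT)
  (fun a _ => is_primitive_sum (index_enum 'I_m) (P := xpredT)
  (fun b _ => is_primitiveZ (Q a b) (is_primitiveM (zv a) (zv b)))) t.
have <- : (fun t => bf Q (z t) (z t)) =
    fun t => \sum_a \sum_b Q a b * (z t a 0 * z t b 0).
  by apply/funext => s; rewrite bfE.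
rewrite !bfE -big_split /=; under [X in is_derive _ _ _ X -> _]eq_bigr => a _.
  under eq_bigr => b _ do rewrite mulrDr.
  rewrite big_split /=; over.
by [].
Qed.

Definition vmom p u t : 'cV[R]_n := \col_a mom tau p (fun s => u s a 0) t.

Lemma vmom_suml (I : Type) (r : seq I) (P : pred I) (c : I -> R)
    (F : I -> {poly R}) u t : vcontinuous u ->
  vmom (\sum_(i <- r | P i) c i *: F i) u t =
  \sum_(i <- r | P i) c i *: vmom (F i) u t.
Proof.
move=> cu; apply/colP => a; rewrite summxE mxE mom_suml//.
by apply: eq_bigr => i _; rewrite !mxE momZl.
Qed.

Lemma mom_bf p (Q : 'M[R]_n) (c : 'cV[R]_n) u t : vcontinuous u ->
  mom tau p (fun s => bf Q c (u s)) t = bf Q c (vmom p u t).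
Proof.
move=> cu; have cc a b : continuous (fun s => Q a b * (c a 0 * u s b 0)).
  apply: continuous_mul; first exact: cst_continuous.
  by apply: continuous_mul => //; exact: cst_continuous.
have -> : (fun s => bf Q c (u s)) =
    fun s => \sum_a \sum_b Q a b * (c a 0 * u s b 0).
  by apply/funext => s; rewrite bfE.
rewrite mom_sumr; last by move=> a _; apply: continuous_sumr.
rewrite bfE; apply: eq_bigr => a _; rewrite mom_sumr//; apply: eq_bigr => b _.
rewrite mxE (_ : (fun s => _) = fun s => (Q a b * c a 0) * u s b 0).
  by rewrite momZr// mulrA.
by apply/funext => s; rewrite mulrA.
Qed.

(* The integral of th^k bf Q e e is nonnegative, where e is u minus its
   projection onto the span of the first N polynomials P_(k,i). *)
Lemma bessel_jacobi k N (Q : 'M[R]_n) u t : vcontinuous u -> spd Q ->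
  tau^-1 * \sum_(i < N) (k + 2 * i + 1)%:R *
    bf Q (vmom (q_poly R k i) u t) (vmom (q_poly R k i) u t)
  <= mom tau 'X^k (fun s => bf Q (u s) (u s)) t.
Proof.
move=> cu Qspd; have tau0 : tau != 0 by rewrite gt_eqF.
pose al (i : 'I_N) : R := (k + 2 * i + 1)%:R.
have al0 i : al i != 0 by rewrite pnatr_eq0 addn1.
pose w (i : 'I_N) := vmom (q_poly R k i) u t.
(* The Fourier coefficients: over the window P_(k,i) has squared norm tau / (k + 2i + 1). *)
pose c i := (al i / tau) *: w i.
pose J (i : 'I_N) := jacobi R k i.
pose e s := u s - \sum_i (J i \Po theta tau t).[s] *: c i.
have cJ p : continuous (horner (p \Po theta tau t)) by exact: continuous_horner.
have cbf i : continuous (fun s => bf Q (c i) (u s)).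
  by apply: continuous_bf => // a; exact: cst_continuous.
have cbb : continuous (fun s => bf Q (u s) (u s)) by exact: continuous_bf.
have ce : vcontinuous e.
  move=> a; have -> : (fun s => e s a 0) =
      fun s => u s a 0 - \sum_i (J i \Po theta tau t).[s] * c i a 0.
    apply/funext => s; rewrite !mxE summxE; congr (_ - _).
    by apply: eq_bigr => i _; rewrite mxE.
  move=> s; apply: continuousB; first exact: cu.
  by apply: continuous_sumr => i _; apply: continuous_mul => //; exact: cst_continuous.
have := mom_ge0 tau_gt0 k t (continuous_bf (Q := Q) ce ce) (fun s => spd_ge0 (e s) Qspd).
(* Expand the square of [u] minus its projection; symmetry of [Q] merges the two cross terms. *)
have -> : mom tau 'X^k (fun s => bf Q (e s) (e s)) t =
    mom tau 'X^k (fun s => bf Q (u s) (u s)) t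
    - 2 * \sum_(i < N) mom tau (q_poly R k i) (fun s => bf Q (c i) (u s)) t
    + \sum_i \sum_j bf Q (c i) (c j) * mom tau ('X^k * J i * J j) (fun=> 1) t.
  pose g1 (i : 'I_N) s := 2 * ((q_poly R k i \Po theta tau t).[s] * bf Q (c i) (u s)).
  pose g2 i j s := bf Q (c i) (c j) * ((('X^k * J i * J j) \Po theta tau t).[s] * 1).
  have c1 i : continuous (g1 i).
    by apply: continuous_mul; [exact: cst_continuous|exact: continuous_mul].
  have c2 i j : continuous (g2 i j).
    apply: continuous_mul; first exact: cst_continuous.
    by apply: continuous_mul => //; exact: cst_continuous.
  have -> : 2 * \sum_(i < N) mom tau (q_poly R k i) (fun s => bf Q (c i) (u s)) t =
      rint (t - tau) t (fun s => \sum_i g1 i s).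
    rewrite rint_sum// mulr_sumr; apply: eq_bigr => i _; rewrite rintZ//.
    exact: continuous_mul.
  have -> : \sum_i \sum_j bf Q (c i) (c j) * mom tau ('X^k * J i * J j) (fun=> 1) t =
      rint (t - tau) t (fun s => \sum_i \sum_j g2 i j s).
    rewrite rint_sum; last by move=> i _; exact: continuous_sumr.
    apply: eq_bigr => i _; rewrite rint_sum//; apply: eq_bigr => j _; rewrite rintZ//.
    by apply: continuous_mul => //; exact: cst_continuous.
  rewrite -mulN1r -rintZ; last exact: continuous_sumr.
  have cs : continuous (fun s => -1 * \sum_i g1 i s).
    by apply: continuous_mul; [exact: cst_continuous|exact: continuous_sumr].
  have cT : continuous (fun s => ('X^k \Po theta tau t).[s] * bf Q (u s) (u s)).
    exact: continuous_mul.
  rewrite -!rintD//; last 2 first.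
  - exact: (continuous_add cT cs).
  - by apply: continuous_sumr => i _; exact: continuous_sumr.
  congr rint; apply/funext => s.
  rewrite /e -scaleN1r; set S : 'cV[R]_n := \sum_i _ *: _.
  rewrite bfDl !bfDr !bfZl !bfZr mulN1r [bf Q (u s) S]bfC; last by case: Qspd.
  have -> : bf Q S S = \sum_i \sum_j (J i \Po theta tau t).[s] *
      (J j \Po theta tau t).[s] * bf Q (c i) (c j).
    rewrite bf_suml; apply: eq_bigr => i _; rewrite bfZl bf_sumr mulr_sumr.
    by apply: eq_bigr => j _; rewrite bfZr mulrA.
  have -> : bf Q S (u s) = \sum_i (J i \Po theta tau t).[s] * bf Q (c i) (u s).
    by rewrite bf_suml; apply: eq_bigr => i _; rewrite bfZl.
  have -> : \sum_i g1 i s = 2 * (('X^k \Po theta tau t).[s] *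
      \sum_i (J i \Po theta tau t).[s] * bf Q (c i) (u s)).
    rewrite !mulr_sumr; apply: eq_bigr => i _.
    by rewrite /g1 /Defs.q_poly comp_polyM hornerM -mulrA.
  have -> : \sum_i \sum_j g2 i j s = ('X^k \Po theta tau t).[s] *
      \sum_i \sum_j (J i \Po theta tau t).[s] * (J j \Po theta tau t).[s] * bf Q (c i) (c j).
    rewrite mulr_sumr; apply: eq_bigr => i _; rewrite mulr_sumr; apply: eq_bigr => j _.
    by rewrite /g2 !comp_polyM !hornerM; ring.
  ring.
(* By orthogonality only the diagonal of the double sum survives. With this choice of [c] it equals
   the sum of the cross terms and the left-hand side B of the goal, so 0 <= mom - 2 B + B. *)
under [X in _ - 2 * X]eq_bigr => i _.
  rewrite mom_bf// /c bfZl; over.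
under [X in _ + X]eq_bigr => i _.
  rewrite (bigD1 i)//= [X in _ + X]big1 ?addr0; last first.
    move=> j ji; rewrite mom_jacobi// [_ == _](_ : _ = false) ?mul0r ?mulr0//.
    by apply/eqP => ij; case/eqP: ji; exact: val_inj.
  rewrite mom_jacobi// eqxx -/(al i) /c bfZl bfZr.
  have -> : al i / tau * (al i / tau * bf Q (w i) (w i)) * (tau * (1 / al i)) =
      al i / tau * bf Q (w i) (w i) by
    move: (al0 i); move: (al i) (bf _ _ _) => y z y0; field; rewrite y0 tau0.
  over.
have -> : tau^-1 * (\sum_(i < N) (k + 2 * i + 1)%:R *
      bf Q (vmom (q_poly R k i) u t) (vmom (q_poly R k i) u t)) =
    \sum_i al i / tau * bf Q (w i) (w i).
  by rewrite mulr_sumr; apply: eq_bigr => i _; rewrite mulrA [tau^-1 * _]mulrC.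
lra.
Qed.

End Bessel.

(** * The Lyapunov-Krasovskii functional *)

Section LyapunovFunctional.
Variables (R : realType) (n M : nat) (tau : R) (A Ad1 Ad2 : 'M[R]_n).
Hypotheses (tau_gt0 : 0 < tau) (M_gt0 : (0 < M)%N).
(** Any C^1 function on the line with its derivative; the delay equation enters only at single
    times, as a hypothesis of the lemmas that need it. *)
Variables (z v : R -> 'cV[R]_n).
Hypotheses (v_cont : vcontinuous v) (z_prim : is_vprimitive z v).
Local Notation vmom := (vmom tau).
Implicit Types (t : R) (p : {poly R}).

Let tau_neq0 : tau != 0. Proof. by rewrite gt_eqF. Qed.
Let z_cont : vcontinuous z. Proof. exact: is_vprimitive_continuous z_prim. Qed.

Lemma jacobi0_q_poly l : jacobi R 0 l = q_poly R 0 l.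
Proof. by rewrite /q_poly mul1r. Qed.

Lemma jacobi00 : jacobi R 0 0 = 1.
Proof. by rewrite /jacobi invr1 scale1r derivn0 divp1 mulr1. Qed.

Lemma vmom_legendre p t : (size p <= M)%N ->
  vmom p z t = \sum_(l < M) legendre_coord M p 0 l *: vmom (jacobi R 0 l) z t.
Proof. by move=> /legendre_coordP {1}->; rewrite vmom_suml. Qed.

Lemma vmom_IBP p t :
  vmom p v t = p.[1] *: z t - p.[0] *: z (t - tau) - tau^-1 *: vmom p^`() z t.
Proof. by apply/colP => a; rewrite !mxE (mom_IBP tau_gt0 _ _ (@v_cont a) (@z_prim a)). Qed.

(** The scale [c] is 1 in [eta] and 1 / tau in [zvec]; the factor [tau] in [GammaM] converts the
    second into the first. *)
Definition moments c t : 'cV[R]_(M * n) :=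
  stack (fun l : 'I_M => c *: vmom (jacobi R 0 l) z t).

Definition eta t : 'cV[R]_((1 + M) * n) := col_mx (z t) (moments 1 t).

Definition eta' t : 'cV[R]_((1 + M) * n) :=
  col_mx (v t) (stack (fun l : 'I_M =>
    z t - (-1) ^+ l *: z (t - tau) - tau^-1 *: vmom (jacobi R 0 l)^`() z t)).

Definition zvec t : 'cV[R]_((1 + (1 + M)) * n) :=
  col_mx (z t) (col_mx (z (t - tau)) (moments tau^-1 t)).

(** For the moments this is [is_primitive_mom], since the shifted Legendre polynomials are 1 at 1
    and (-1)^l at 0. *)
Lemma eta_prim : is_vprimitive eta eta'.
Proof.
move=> k; have [i a] := mxtens_indexP k.
have E (u : R -> 'cV[R]_((1 + M) * n)) :
    (fun s => u s (mxtens_index (i, a)) 0) = fun s => block_vec (u s) i a 0.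
  by apply/funext => s; rewrite mxE.
rewrite !{}E; case: (split_ordP i) => l ->.
  rewrite ord1.
  have -> : (fun s => block_vec (eta s) (lshift M ord0) a 0) = fun s => z s a 0.
    by apply/funext => s; rewrite block_vec_head.
  have -> : (fun s => block_vec (eta' s) (lshift M ord0) a 0) = fun s => v s a 0.
    by apply/funext => s; rewrite block_vec_head.
  exact: z_prim.
have -> : (fun s => block_vec (eta s) (rshift 1 l) a 0) =
    mom tau (jacobi R 0 l) (fun s => z s a 0).
  by apply/funext => s; rewrite block_vec_tail stackK scale1r mxE.
have -> : (fun s => block_vec (eta' s) (rshift 1 l) a 0) = fun t => z t a 0
    - (-1) ^+ l * z (t - tau) a 0 - tau^-1 * mom tau (jacobi R 0 l)^`() (fun s => z s a 0) t.
  by apply/funext => s; rewrite block_vec_tail stackK !mxE.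
move=> t; have := is_primitive_mom tau_gt0 (jacobi R 0 l) (@z_cont a) t.
by rewrite jacobi0_q_poly q_poly1 q_poly0 mul1r.
Qed.

Lemma sum_zvec (c : 'I_(1 + (1 + M)) -> R) t :
  \sum_j c j *: block_vec (zvec t) j =
  c (lshift _ ord0) *: z t + (c (rshift 1 (lshift M ord0)) *: z (t - tau)
  + tau^-1 *: \sum_l c (rshift 1 (rshift 1 l)) *: vmom (jacobi R 0 l) z t).
Proof.
rewrite big_split_ord big_ord1 /= block_vec_head; congr (_ + _).
rewrite big_split_ord big_ord1 /= block_vec_tail block_vec_head; congr (_ + _).
rewrite scaler_sumr; apply: eq_bigr => l _.
by rewrite !block_vec_tail stackK !scalerA mulrC.
Qed.

(** This is the meaning of the rows [zeta]: integrating by parts turns a moment of [v] into boundary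
    values and a moment of [z] with weight q'. As q' has degree below k + i <= M, it expands in the
    first [M] Legendre polynomials. *)
Lemma sum_zeta k i t : (k + i <= M)%N ->
  \sum_j zeta R M k i 0 j *: block_vec (zvec t) j = vmom (q_poly R k i) v t.
Proof.
move=> kiM; rewrite (sum_zvec (fun j => zeta R M k i 0 j)) vmom_IBP vmom_legendre; last first.
  apply: leq_trans kiM; rewrite -ltnS; have := size_q_poly R k i.
  have [->|q0] := eqVneq (q_poly R k i) 0; first by rewrite derivC size_poly0.
  by apply: leq_trans; exact: lt_size_deriv.
rewrite q_poly1 q_poly0 /zeta row_mxEl mxE eqxx mulr1n !row_mxEr row_mxEl mxE eqxx mulr1n.
rewrite -addrA; congr (_ + _); congr (_ + _).
  by rewrite -scaleNr; congr (_ *: _); case: eqP => _; rewrite ?oppr0// exprS mulN1r.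
rewrite -scalerN; congr (_ *: _); rewrite -sumrN; apply: eq_bigr => l _.
by rewrite !row_mxEr mxE scaleNr.
Qed.

(** Only the moment against P_(0,0) = 1 is used; its normalization 1 / tau cancels the [tau] in
    front of [Ad2]. *)
Lemma mul_Acal t : Acal M tau A Ad1 Ad2 *m zvec t =
  A *m z t + Ad1 *m z (t - tau) + Ad2 *m vmom 1 z t.
Proof.
have -> : Acal M tau A Ad1 Ad2 *m zvec t = A *m z t +
    row_mx Ad1 (block_row (fun l : 'I_M => if l == 0%N :> nat then tau *: Ad2 else 0))
      *m (col_mx (z (t - tau)) (moments tau^-1 t)) := mul_row_col _ _ _ _.
rewrite mul_row_col block_row_mul (bigD1 (Ordinal M_gt0))//= big1 ?addr0.
  rewrite stackK /= jacobi00 -scalemxAl -scalemxAr scalerA mulfV// scale1r.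
  by rewrite addrA.
by move=> l l0; rewrite ifN ?mul0mx.
Qed.

(** The first block is the delay equation. The others are [sum_zeta] for k = 0: the Legendre moments
    of [v] are the derivatives of those of [z]. *)
Lemma mul_LambdaM t :
  v t = A *m z t + Ad1 *m z (t - tau) + Ad2 *m vmom 1 z t ->
  LambdaM M tau A Ad1 Ad2 *m zvec t = eta' t.
Proof.
rewrite -mul_Acal => vt.
have -> : LambdaM M tau A Ad1 Ad2 *m zvec t = col_mx (Acal M tau A Ad1 Ad2 *m zvec t)
    ((Ltilde0 R M *t (1%:M : 'M[R]_n)) *m zvec t) := mul_col_mx _ _ _.
rewrite -vt; congr col_mx; apply: block_vecP => l; rewrite block_vec_tens stackK.
transitivity (vmom (q_poly R 0 l) v t).
  rewrite -(@sum_zeta 0 l t (ltnW (ltn_ord l))); apply: eq_bigr => j _.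
  rewrite [in LHS]mxE; congr (_ *: _).
by rewrite vmom_IBP q_poly1 q_poly0 scale1r jacobi0_q_poly.
Qed.

Lemma mul_GammaM t : GammaM n M tau *m zvec t = eta t.
Proof.
apply: block_vecP => i; rewrite block_vec_tens; set X := block_mx _ _ _ _.
rewrite (sum_zvec (fun j => X i j)) {}/X; case: (split_ordP i) => l ->.
  rewrite ord1 block_vec_head block_mxEul !block_mxEur !mxE eqxx mulr1n scale1r.
  by rewrite scale0r add0r big1 ?scaler0 ?addr0// => j _; rewrite block_mxEur mxE scale0r.
rewrite block_vec_tail stackK block_mxEdl !block_mxEdr row_mxEl !mxE !scale0r !add0r.
rewrite (bigD1 l)//= big1 ?addr0 => [|j jl].
  by rewrite block_mxEdr row_mxEr mxE eqxx mulr1n scalerA mulVf.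
by rewrite block_mxEdr row_mxEr mxE eq_sym (negPf jl) mulr0n scale0r.
Qed.

(** [Xi] changes basis from the Legendre polynomials to the q_(j,j+i), so the quadratic form becomes
    the weighted sum of Bessel's inequality. *)
Lemma bf_XiI nu1 (Q : nat -> 'M[R]_n) k j c t : (j + nu1 j < M)%N ->
  bf ((XiI R n M nu1 j)^T *m Qcal nu1 Q k j *m XiI R n M nu1 j) (moments c t) (moments c t) =
  c ^+ 2 * \sum_(i < (nu1 j).+1) (j + 2 * i + 1)%:R *
    bf (Q k) (vmom (q_poly R j i) z t) (vmom (q_poly R j i) z t).
Proof.
move=> jM; rewrite bf_mul bf_diag_tens mulr_sumr; apply: eq_bigr => i _.
have -> : block_vec (XiI R n M nu1 j *m moments c t) i = c *: vmom (q_poly R j i) z t.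
  rewrite block_vec_tens vmom_legendre; last first.
    apply: leq_trans (size_q_poly R j i) _; apply: leq_ltn_trans jM.
    by rewrite leq_add2l -ltnS.
  rewrite scaler_sumr; apply: eq_bigr => l _.
  by rewrite stackK mxE !scalerA mulrC.
by rewrite bfZl bfZr mxE; ring.
Qed.

Lemma bf_Psi0 m1 nu1 (P : 'M[R]_((1 + M) * n)) (Q : nat -> 'M[R]_n) t :
    (forall j, (j <= m1)%N -> (m1 + nu1 j < M)%N) ->
  bf (Psi0 tau m1 nu1 P Q) (eta t) (eta t) = tau * bf P (eta t) (eta t) +
  \sum_(0 <= j < m1.+1) \sum_(i < (nu1 j).+1) (j + 2 * i + 1)%:R *
    bf (Q j) (vmom (q_poly R j i) z t) (vmom (q_poly R j i) z t).
Proof.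
move=> hnu; rewrite /Psi0 bfDm bfZm bf_summ; congr (_ + _).
rewrite !big_mkord; apply: eq_bigr => j _.
rewrite [LHS]bf_block_diag bf0m add0r bf_XiI ?expr1n ?mul1r//.
have jm : (j <= m1)%N by rewrite -ltnS.
by apply: leq_ltn_trans (hnu _ jm); rewrite leq_add2r.
Qed.

Lemma bf_Psi1 (P : 'M[R]_((1 + M) * n)) t :
  v t = A *m z t + Ad1 *m z (t - tau) + Ad2 *m vmom 1 z t ->
  bf (Psi1 tau A Ad1 Ad2 P) (zvec t) (zvec t) =
  bf P (eta' t) (eta t) + bf P (eta t) (eta' t).
Proof.
by move=> vt; rewrite /Psi1 bfDm !bf_mul mul_LambdaM// mul_GammaM addrC.
Qed.

Lemma bf_Psi2 m1 nu1 (Q : nat -> 'M[R]_n) t :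
    (forall j, (j <= m1)%N -> (m1 + nu1 j < M)%N) ->
  bf (Psi2 M m1 nu1 Q) (zvec t) (zvec t) =
  \sum_(0 <= j < m1.+1) bf (Q j) (z t) (z t) - bf (Q 0%N) (z (t - tau)) (z (t - tau))
  - \sum_(1 <= j < m1.+1) j%:R * (tau^-1 ^+ 2 * \sum_(i < (nu1 j.-1).+1)
      (j.-1 + 2 * i + 1)%:R *
      bf (Q j) (vmom (q_poly R j.-1 i) z t) (vmom (q_poly R j.-1 i) z t)).
Proof.
move=> hnu; rewrite [LHS]bf_block_diag bf_block_diag !bfNm !bf_summ -addrA.
congr (_ + (_ - _)); rewrite !big_add1 !big_mkord /=; apply: eq_bigr => j _.
rewrite bfZm bf_XiI//.
have jm : (j <= m1)%N by rewrite ltnW.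
by apply: leq_ltn_trans (hnu _ jm); rewrite leq_add2r.
Qed.

Lemma bf_Psi31 m2 (Rm : nat -> 'M[R]_n) t :
  v t = A *m z t + Ad1 *m z (t - tau) + Ad2 *m vmom 1 z t ->
  bf (Psi31 M tau m2 A Ad1 Ad2 Rm) (zvec t) (zvec t) =
  tau * \sum_(1 <= j < m2.+1) bf (Rm j) (v t) (v t).
Proof. by move=> vt; rewrite /Psi31 bfZm bf_mul mul_Acal -vt bf_summ. Qed.

Lemma bf_Psi32 m2 nu2 (Rm : nat -> 'M[R]_n) t :
    (forall j, (j <= m2)%N -> (m2 + nu2 j <= M)%N) ->
  bf (Psi32 M tau m2 nu2 Rm) (zvec t) (zvec t) =
  tau^-1 * \sum_(1 <= j < m2.+1) j%:R * \sum_(i < (nu2 j.-1).+1)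
      (j.-1 + 2 * i + 1)%:R *
      bf (Rm j) (vmom (q_poly R j.-1 i) v t) (vmom (q_poly R j.-1 i) v t).
Proof.
move=> hnu; rewrite /Psi32 bfZm bf_summ; congr (_ * _).
rewrite !big_add1 !big_mkord /=; apply: eq_bigr => j _; rewrite bfZm bf_mul.
congr (_ * _); rewrite bf_diag_tens; apply: eq_bigr => i _; rewrite mxE.
have -> : block_vec (ZI R n M nu2 j *m zvec t) i = vmom (q_poly R j i) v t.
  rewrite block_vec_tens -sum_zeta; first by apply: eq_bigr => k _; rewrite mxE.
  have jm : (j <= m2)%N by rewrite ltnW.
  by apply: leq_trans (hnu _ jm); rewrite leq_add// ?(ltnW (ltn_ord j))// -ltnS.
by [].
Qed.

Variables (m1 m2 : nat) (nu1 nu2 : nat -> nat).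
Variables (P : 'M[R]_((1 + M) * n)) (Q Rm : nat -> 'M[R]_n).
Hypotheses (nu1M : forall j, (j <= m1)%N -> (m1 + nu1 j < M)%N)
           (nu2M : forall j, (j <= m2)%N -> (m2 + nu2 j <= M)%N)
           (Qspd : forall j, (j <= m1)%N -> spd (Q j))
           (Rspd : forall j, (1 <= j <= m2)%N -> spd (Rm j)).

Definition krasovskii t := bf P (eta t) (eta t)
  + \sum_(0 <= j < m1.+1) mom tau 'X^j (fun s => bf (Q j) (z s) (z s)) t
  + tau * \sum_(1 <= j < m2.+1) mom tau 'X^j (fun s => bf (Rm j) (v s) (v s)) t.

Let mom_deriv (g : R -> R) p t :=
  p.[1] * g t - p.[0] * g (t - tau) - tau^-1 * mom tau p^`() g t.

Definition krasovskii_deriv t := bf P (eta' t) (eta t) + bf P (eta t) (eta' t)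
  + \sum_(0 <= j < m1.+1) mom_deriv (fun s => bf (Q j) (z s) (z s)) 'X^j t
  + tau * \sum_(1 <= j < m2.+1) mom_deriv (fun s => bf (Rm j) (v s) (v s)) 'X^j t.

Let cz j : continuous (fun s => bf (Q j) (z s) (z s)).
Proof. exact: continuous_bf. Qed.

Let cv j : continuous (fun s => bf (Rm j) (v s) (v s)).
Proof. exact: continuous_bf. Qed.

Lemma krasovskii_prim : is_primitive krasovskii krasovskii_deriv.
Proof.
apply: is_primitiveD; first apply: is_primitiveD.
- exact: is_primitive_bf eta_prim.
- by apply: is_primitive_sum => j _; apply: is_primitive_mom => //; exact: cz.
- apply: is_primitiveZ; apply: is_primitive_sum => j _.
  by apply: is_primitive_mom => //; exact: cv.
Qed.

(** Bessel's inequality bounds the integrals with [Q] from below, and the nonnegative integrals with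
    [Rm] are dropped. *)
Lemma krasovskii_ge t : tau^-1 * bf (Psi0 tau m1 nu1 P Q) (eta t) (eta t) <= krasovskii t.
Proof.
rewrite bf_Psi0// mulrDr mulKf// /krasovskii -[leLHS]addr0 lerD//; last first.
  apply: mulr_ge0; first exact: ltW.
  rewrite big_add1 big_mkord; apply: sumr_ge0 => j _.
  by apply: mom_ge0 => // s; apply: spd_ge0; apply: Rspd; rewrite /= ltn_ord.
rewrite lerD2l mulr_sumr; apply: ler_sum_nat => j /andP[_ jm].
exact: bessel_jacobi (Qspd jm).
Qed.

Lemma krasovskii_deriv_le t :
  v t = A *m z t + Ad1 *m z (t - tau) + Ad2 *m vmom 1 z t ->
  krasovskii_deriv t <= bf (Psi1 tau A Ad1 Ad2 P + Psi2 M m1 nu1 Q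
    + Psi31 M tau m2 A Ad1 Ad2 Rm - Psi32 M tau m2 nu2 Rm) (zvec t) (zvec t).
Proof.
move=> vt; rewrite 2!(bfDm (_ + _)) bfDm bfNm bf_Psi1// bf_Psi2// bf_Psi31// bf_Psi32//.
rewrite /krasovskii_deriv -!addrA lerD2l.
(* For a positive exponent the weight vanishes at the left end of the window, so the only delayed
   boundary term is that of exponent 0. *)
have derX j (g : R -> R) : continuous g ->
    mom_deriv g 'X^(j.+1) t = g t - j.+1%:R * (tau^-1 * mom tau 'X^j g t).
  move=> cg; rewrite /mom_deriv !hornerXn expr1n expr0n mul1r mul0r subr0.
  by rewrite derivXn /= -scaler_nat momZl// mulrCA.
have der0 (g : R -> R) : continuous g -> mom_deriv g 'X^0 t = g t - g (t - tau).
  move=> cg; rewrite /mom_deriv expr0 derivC -[in mom _ _ _](scale0r 0) momZl//.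
  by rewrite mul0r mulr0 subr0 !hornerC !mul1r.
have -> : \sum_(0 <= j < m1.+1) mom_deriv (fun s => bf (Q j) (z s) (z s)) 'X^j t =
    \sum_(0 <= j < m1.+1) bf (Q j) (z t) (z t) - bf (Q 0%N) (z (t - tau)) (z (t - tau))
    - \sum_(1 <= j < m1.+1) j%:R * (tau^-1 * mom tau 'X^(j.-1) (fun s => bf (Q j) (z s) (z s)) t).
  rewrite !(big_ltn (ltn0Sn m1)) der0; last exact: cz.
  rewrite [X in _ = X - _]addrAC -[RHS]addrA; congr (_ + _); rewrite -sumrB.
  by rewrite !big_add1; apply: eq_bigr => j _; rewrite derX//; exact: cz.
have -> : \sum_(1 <= j < m2.+1) mom_deriv (fun s => bf (Rm j) (v s) (v s)) 'X^j t =
    \sum_(1 <= j < m2.+1) bf (Rm j) (v t) (v t)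
    - \sum_(1 <= j < m2.+1) j%:R * (tau^-1 * mom tau 'X^(j.-1) (fun s => bf (Rm j) (v s) (v s)) t).
  by rewrite -sumrB !big_add1; apply: eq_bigr => j _; rewrite derX//; exact: cv.
have tauV0 : 0 <= tau^-1 by rewrite invr_ge0 ltW.
pose S1 := \sum_(1 <= j < m1.+1) j%:R *
  (tau^-1 * mom tau 'X^(j.-1) (fun s => bf (Q j) (z s) (z s)) t).
pose S2 := \sum_(1 <= j < m2.+1) j%:R *
  (tau^-1 * mom tau 'X^(j.-1) (fun s => bf (Rm j) (v s) (v s)) t).
pose T1 := \sum_(1 <= j < m1.+1) j%:R * (tau^-1 ^+ 2 * \sum_(i < (nu1 j.-1).+1)
  (j.-1 + 2 * i + 1)%:R *
  bf (Q j) (vmom (q_poly R j.-1 i) z t) (vmom (q_poly R j.-1 i) z t)).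
pose T2 := tau^-1 * \sum_(1 <= j < m2.+1) j%:R * \sum_(i < (nu2 j.-1).+1)
  (j.-1 + 2 * i + 1)%:R *
  bf (Rm j) (vmom (q_poly R j.-1 i) v t) (vmom (q_poly R j.-1 i) v t).
rewrite -/S1 -/S2 -/T1 -/T2.
have h1 : T1 <= S1.
  rewrite /T1 /S1 !big_add1; apply: ler_sum_nat => j /andP[_ jm].
  rewrite ler_wpM2l// expr2 -mulrA ler_wpM2l//.
  by apply: bessel_jacobi => //; exact: Qspd.
(* The factor [tau] of the functional cancels the 1 / tau from differentiating the weight; the 1 /
   tau of [Psi32] comes from Bessel's inequality. In [h1] both factors 1 / tau remain. *)
have h2 : T2 <= tau * S2.
  rewrite /T2 /S2 !big_add1 !mulr_sumr; apply: ler_sum_nat => j /andP[_ jm].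
  rewrite [tau * (_ * _)]mulrCA mulVKf// mulrCA ler_wpM2l//.
  by apply: bessel_jacobi => //; exact: Rspd.
rewrite mulrBr; lra.
Qed.

End LyapunovFunctional.

(** * Barbalat's argument and an upper bound for the functional *)

Section Estimates.
Variable R : realType.

Lemma is_primitive_nincr (W w : R -> R) t0 : is_primitive W w ->
  (forall t, t0 <= t -> w t <= 0) -> forall s t, t0 <= s -> s <= t -> W t <= W s.
Proof.
move=> Ww w0 s t t0s st; have [c /andP[sc _] E] := is_primitive_MVT Ww st.
by rewrite -subr_le0 E mulr_le0_ge0 ?subr_ge0// w0// (le_trans t0s).
Qed.

(** [W] decreases to its infimum. If f(t) >= e, then f stays above e / 2 on an interval of length
    [h], and [W] loses at least e h / 2 there; this is impossible once [W] is closer than that to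
    its infimum. *)
Lemma barbalat (W w f f' : R -> R) t0 D :
    is_primitive W w -> is_primitive f f' -> 0 < D ->
    (forall t, t0 <= t -> 0 <= W t) -> (forall t, t0 <= t -> 0 <= f t) ->
    (forall t, t0 <= t -> w t <= - f t) -> (forall t, t0 <= t -> `|f' t| <= D) ->
  forall e, 0 < e -> exists2 T, t0 <= T & forall t, T <= t -> f t < e.
Proof.
move=> Ww ff D0 W0 f0 wf f'D e e0.
(* Below, [h] is the time in which [f], of slope at most [D], can change by e / 2. *)
have wn : forall s t, t0 <= s -> s <= t -> W t <= W s.
  by apply: is_primitive_nincr => // t tt; rewrite (le_trans (wf _ tt))// oppr_le0 f0.
pose h := e / (2 * D); have h0 : 0 < h by rewrite divr_gt0// mulr_gt0.
pose S := [set W t | t in [set t | t0 <= t]].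
have Sinf : has_inf S.
  split; first by exists (W t0); exists t0 => //=.
  by exists 0 => _ [t tt <-]; exact: W0.
have d0 : 0 < e / 2 * h by rewrite mulr_gt0// divr_gt0.
have [_ [T tT <-] WT] := inf_adherent d0 Sinf.
exists T => // t Tt; rewrite ltNge; apply/negP => ef.
have t0t : t0 <= t by rewrite (le_trans tT).
have th : t <= t + h by rewrite lerDl ltW.
have [c /andP[tc ch]] := is_primitive_MVT Ww th; rewrite addrAC subrr add0r => E.
have [c' /andP[tc' c'c] E'] := is_primitive_MVT ff tc.
have fc : e / 2 <= f c.
  have : `|f c - f t| <= D * h.
    rewrite E' normrM; apply: ler_pM => //; first by rewrite f'D// (le_trans t0t).
    by rewrite ger0_norm ?subr_ge0// lerBlDl.
  have -> : D * h = e / 2 by rewrite /h; field; rewrite gt_eqF.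
  by rewrite ler_norml => /andP[+ _]; lra.
have infW : inf S <= W (t + h).
  apply: ge_inf; first by case: Sinf.
  by exists (t + h) => //=; rewrite (le_trans t0t).
have WtT : W t <= W T by exact: wn.
have : w c * h <= - (e / 2) * h.
  by rewrite ler_wpM2r ?(ltW h0)// (le_trans (wf c _)) ?(le_trans t0t)// lerN2.
by rewrite mulNr; lra.
Qed.

(** The constant is independent of the functions [z] and [v], which makes the final estimate uniform
    over all solutions. *)
Lemma krasovskii_le n M (tau : R) m1 m2 (P : 'M[R]_((1 + M) * n))
    (Q Rm : nat -> 'M[R]_n) : 0 < tau ->
  exists2 C, 0 <= C & forall (z v : R -> 'cV[R]_n) t B,
    vcontinuous z -> vcontinuous v -> 0 <= B ->
    (forall s a, t - tau <= s <= t -> `|z s a 0| <= B /\ `|v s a 0| <= B) ->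
    krasovskii tau z v m1 m2 P Q Rm t <= C * B ^+ 2.
Proof.
move=> tau0.
pose nc (p : {poly R}) := \sum_(i < size p) `|p`_i|.
pose nm k (S : 'M[R]_k) := \sum_a \sum_b `|S a b|.
have nc0 p : 0 <= nc p by exact: sumr_ge0.
have nm0 k (S : 'M[R]_k) : 0 <= nm k S by apply: sumr_ge0 => a _; exact: sumr_ge0.
(* Times [B], this dominates every entry of [eta]: the 1 is for z(t), each summand for one Legendre
   moment. *)
pose K := 1 + \sum_(l < M) nc (jacobi R 0 l) * tau.
have K0 : 0 <= \sum_(l < M) nc (jacobi R 0 l) * tau.
  by apply: sumr_ge0 => l _; rewrite mulr_ge0// ltW.
exists (nm _ P * K ^+ 2 + \sum_(0 <= j < m1.+1) nc 'X^j * nm _ (Q j) * tau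
  + tau * \sum_(1 <= j < m2.+1) nc 'X^j * nm _ (Rm j) * tau).
  have sum0 a b (F : nat -> 'M[R]_n) :
      0 <= \sum_(a <= j < b) nc 'X^j * nm _ (F j) * tau.
    by apply: sumr_ge0 => j _; rewrite !mulr_ge0// ltW.
  by rewrite !addr_ge0 ?[0 <= tau * _]mulr_ge0 ?(ltW tau0)// mulr_ge0 ?sqr_ge0.
move=> z v t B cz cv B0 zvB; rewrite /krasovskii 2!mulrDl; apply: lerD; first apply: lerD.
- apply: le_trans (ler_norm _) _; rewrite -mulrA -exprMn; apply: normr_bf_le => k.
  have [i a] := mxtens_indexP k.
  have -> : eta M tau z t (mxtens_index (i, a)) 0 = block_vec (eta M tau z t) i a 0.
    by rewrite [RHS]mxE.
  have tt : t - tau <= t <= t by rewrite lexx gerBl ltW.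
  case: (split_ordP i) => l ->.
    rewrite ord1 block_vec_head /K mulrDl mul1r.
    by apply: le_trans (zvB t a tt).1 _; rewrite lerDl mulr_ge0.
  rewrite block_vec_tail stackK scale1r mxE.
  have := normr_mom tau0 (jacobi R 0 l) (@cz a) (fun s st => (zvB s a st).1).
  move=> /le_trans; apply; rewrite -/(nc _) mulrAC; apply: ler_wpM2r => //.
  rewrite /K (bigD1 l)//= addrCA lerDl addr_ge0// sumr_ge0// => i' _.
  by rewrite mulr_ge0// ltW.
- rewrite mulr_suml; apply: ler_sum => j _; apply: le_trans (ler_norm _) _.
  have := @normr_mom _ _ tau0 'X^j (fun s => bf (Q j) (z s) (z s)) t (nm _ (Q j) * B ^+ 2).
  rewrite -/(nc _) => h; apply: le_trans (h _ _) _; first exact: continuous_bf.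
    by move=> s st; apply: normr_bf_le => a; exact: (zvB s a st).1.
  by rewrite le_eqVlt; apply/orP; left; apply/eqP; ring.
- rewrite -mulrA; apply: ler_wpM2l; first exact: ltW.
  rewrite mulr_suml; apply: ler_sum => j _; apply: le_trans (ler_norm _) _.
  have := @normr_mom _ _ tau0 'X^j (fun s => bf (Rm j) (v s) (v s)) t (nm _ (Rm j) * B ^+ 2).
  rewrite -/(nc _) => h; apply: le_trans (h _ _) _; first exact: continuous_bf.
    by move=> s st; apply: normr_bf_le => a; exact: (zvB s a st).2.
  by rewrite le_eqVlt; apply/orP; left; apply/eqP; ring.
Qed.

End Estimates.

(** * Solutions of the delay equation *)

Section Solutions.
Variables (R : realType) (n : nat) (tau : R) (A Ad1 Ad2 : 'M[R]_n).
Hypothesis tau_gt0 : 0 < tau.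
Implicit Types (x y : R -> 'cV[R]_n) (t s : R).
Local Notation mu := (@lebesgue_measure R).

(** The primitives start at 0 and see values outside [a, b]; passing to the Lebesgue integral shows
    that these do not matter. *)
Lemma rint_eq (f g : R -> R) a b : continuous f -> continuous g -> a <= b ->
  (forall s, a <= s <= b -> f s = g s) -> rint a b f = rint a b g.
Proof.
move=> cf cg ab fg; rewrite -!rint_Rintegral//; apply: eq_Rintegral => s.
by rewrite inE /= in_itv /=; exact: fg.
Qed.

Lemma vintegralE y t : vcontinuous y -> vintegral (t - tau) t y = vmom tau 1 y t.
Proof.
move=> cy; apply/colP => i; rewrite !mxE rint_Rintegral//; last by rewrite gerBl ltW.
by congr rint; apply/funext => s; rewrite comp_polyC hornerC mul1r.
Qed.

Lemma vmom1_eq x y t : vcontinuous x -> vcontinuous y ->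
  (forall s, t - tau <= s <= t -> x s = y s) -> vmom tau 1 x t = vmom tau 1 y t.
Proof.
move=> cx cy xy; have tt : t - tau <= t by rewrite gerBl ltW.
apply/colP => a; rewrite !mxE; apply: rint_eq => //.
- by apply: continuous_mul => //; exact: continuous_horner.
- by apply: continuous_mul => //; exact: continuous_horner.
- by move=> s st; rewrite xy.
Qed.

(* [x] continued by a constant before [- tau], to be continuous on the whole line. *)
Definition extend x s := x (Num.max s (- tau)).

Lemma extendE x s : - tau <= s -> extend x s = x s.
Proof. by move=> h; rewrite /extend max_l. Qed.

Lemma continuous_extend x : {within `[- tau, +oo[, continuous x} -> continuous (extend x).
Proof.
move=> /subspace_continuousP cx s; pose m r := Num.max r (- tau).
have cm : continuous m.
  have -> : m = fun r => 2^-1 * (r + - tau + `|r + tau|).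
    by apply/funext => r; rewrite /m maxr_absE opprK mulrC.
  apply: continuous_mul; first exact: cst_continuous.
  apply: continuous_add.
    by apply: continuous_add; [move=> r; exact: cvg_id|exact: cst_continuous].
  move=> r; apply: (@continuous_comp _ _ _ (fun r => r + tau) (fun r => `|r|)).
    by apply: continuousD; [exact: cvg_id|exact: cvg_cst].
  exact: norm_continuous.
(* The clamping map lands in the half-line, so continuity of [x] relative to the half-line
   suffices. *)
have mA r : `[- tau, +oo[%classic (m r) by rewrite /= in_itv /= andbT le_max lexx orbT.
apply: (@cvg_comp _ _ _ m x _ (within `[- tau, +oo[%classic (nbhs (m s)))).
  move=> U /cm mU; apply: (@filterS _ (nbhs s) _ _ _ _ mU) => r; apply; exact: mA.
exact: cx.
Qed.

Definition velocity y t := A *m y t + Ad1 *m y (t - tau) + Ad2 *m vmom tau 1 y t.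

Lemma velocity_continuous y : vcontinuous y -> vcontinuous (velocity y).
Proof.
move=> cy a; have cm (B : 'M[R]_n) (u : R -> 'cV[R]_n) : vcontinuous u ->
    continuous (fun s => (B *m u s) a 0).
  move=> cu; have -> : (fun s => (B *m u s) a 0) = fun s => \sum_j B a j * u s j 0.
    by apply/funext => s; rewrite mxE.
  apply: continuous_sumr => j _; apply: continuous_mul; first exact: cst_continuous.
  exact: cu.
have -> : (fun s => velocity y s a 0) = fun s =>
    (A *m y s) a 0 + (Ad1 *m y (s - tau)) a 0 + (Ad2 *m vmom tau 1 y s) a 0.
  by apply/funext => s; rewrite !mxE.
apply: continuous_add; first apply: continuous_add; apply: cm => //.
- move=> b s; apply: (@continuous_comp _ _ _ (fun s => s - tau) (fun s => y s b 0)).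
    by apply: continuousB; [exact: cvg_id|exact: cvg_cst].
  exact: cy.
- move=> b; have -> : (fun s => vmom tau 1 y s b 0) = mom tau 1 (fun s => y s b 0).
    by apply/funext => s; rewrite mxE.
  exact: is_primitive_continuous (is_primitive_mom tau_gt0 1 (cy b)).
Qed.

Definition growth := \sum_a \sum_b (`|A a b| + `|Ad1 a b| + tau * `|Ad2 a b|).

Lemma growth_ge0 : 0 <= growth.
Proof.
by do 2!(apply: sumr_ge0 => ? _); rewrite !addr_ge0// mulr_ge0// ltW.
Qed.

Lemma velocity_le y t B a : vcontinuous y -> 0 <= B ->
  (forall s b, t - tau <= s <= t -> `|y s b 0| <= B) ->
  `|velocity y t a 0| <= growth * B.
Proof.
move=> cy B0 yB; have tt : t - tau <= t by rewrite gerBl ltW.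
have mB b : `|vmom tau 1 y t b 0| <= tau * B.
  rewrite mxE; have := normr_mom tau_gt0 1 (@cy b) (fun s st => yB s b st).
  by rewrite size_poly1 big_ord1 coefC /= normr1 mul1r mulrC.
apply: (@le_trans _ _ (\sum_b (`|A a b| + `|Ad1 a b| + tau * `|Ad2 a b|) * B)); last first.
  rewrite -mulr_suml ler_wpM2r// /growth [leRHS](bigD1 a)//= lerDl.
  by do 2!(apply: sumr_ge0 => ? _); rewrite !addr_ge0// mulr_ge0// ltW.
rewrite !mxE -!big_split /=; apply: le_trans (ler_norm_sum _ _ _) _.
apply: ler_sum => b _; apply: le_trans (ler_normD _ _) _.
rewrite 2!mulrDl lerD//.
  apply: le_trans (ler_normD _ _) _; rewrite !normrM lerD// ler_wpM2l// yB//.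
    by rewrite tt lexx.
  by rewrite lexx tt.
by rewrite normrM [tau * _]mulrC -mulrA ler_wpM2l.
Qed.

Variable x : R -> 'cV[R]_n.
Hypothesis x_cont : {within `[- tau, +oo[, continuous x}.
Hypothesis x_deriv : forall t, 0 < t -> is_derive t (1 : R) x (delay_rhs tau A Ad1 Ad2 x t).

Let y := extend x.
Definition sol_deriv := velocity (extend x).
(* A function of class C^1 on the whole line that coincides with [x] after 0, whereas
   [x] need not be differentiable before 0. *)
Definition sol t : 'cV[R]_n := \col_a (x 0 a 0 + primitive (fun s => sol_deriv s a 0) t).

Let y_cont : vcontinuous y.
Proof.
move=> a s; apply: (@continuous_comp _ _ _ y (fun u : 'cV[R]_n => u a 0)).
  exact: continuous_extend.
exact: coord_continuous.
Qed.

Lemma sol_deriv_cont : vcontinuous sol_deriv.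
Proof. exact: velocity_continuous. Qed.

Lemma sol_prim : is_vprimitive sol sol_deriv.
Proof.
move=> a; have -> : (fun s => sol s a 0) =
    fun s => x 0 a 0 + primitive (fun s => sol_deriv s a 0) s.
  by apply/funext => s; rewrite mxE.
move=> t; rewrite -[sol_deriv t a 0]add0r.
exact: (is_primitiveD (is_primitive_cst _) (primitiveP (@sol_deriv_cont a))).
Qed.

Lemma delay_rhs_velocity t : 0 <= t -> delay_rhs tau A Ad1 Ad2 x t = sol_deriv t.
Proof.
move=> t0; rewrite /delay_rhs /sol_deriv /velocity -vintegralE// !extendE.
- congr (_ + _ *m _); apply/colP => i; rewrite !mxE; apply: eq_Rintegral => s.
  rewrite inE /= in_itv /= => /andP[ts _]; rewrite extendE//.
  by apply: le_trans ts; rewrite lerBrDl subrr.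
- by rewrite lerBrDl subrr.
- by rewrite (le_trans _ t0)// oppr_le0 ltW.
Qed.

(** The difference of the two functions vanishes at 0, is continuous on [0, t] and has zero
    derivative inside. The mean value theorem needs no differentiability of [x] at 0. *)
Lemma solE t : 0 <= t -> sol t = x t.
Proof.
move=> t0; apply/colP => a.
pose d s := y s a 0 - sol s a 0.
have d0 : d 0 = 0.
  by rewrite /d /y extendE ?oppr_le0 ?ltW// mxE /primitive subrr addr0 subrr.
suff : d t = d 0.
  rewrite d0 /d /y extendE; first by move/eqP; rewrite subr_eq0 => /eqP.
  by rewrite (le_trans _ t0)// oppr_le0 ltW.
have [||c _] := @MVT_segment R d (fun=> 0) 0 t t0.
- move=> s; rewrite in_itv /= => /andP[s0 _].
  have dx : is_derive s (1 : R) (fun s => x s a 0) (sol_deriv s a 0).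
    rewrite -delay_rhs_velocity ?ltW//; have [dx <-] := x_deriv s0.
    rewrite derive_mx// mxE; apply: DeriveDef => //.
    by move/derivable_mxP : dx; exact.
  have dy : is_derive s (1 : R) (fun s => y s a 0) (sol_deriv s a 0).
    apply: near_eq_is_derive dx; near=> r; rewrite /y extendE//.
    rewrite (@le_trans _ _ 0) ?oppr_le0 ?(ltW tau_gt0)// ltW//.
    by near: r; exact: lt_nbhsr.
  rewrite -(subrr (sol_deriv s a 0)); exact: is_deriveB dy (sol_prim a s).
- apply: continuous_subspaceT => s; apply: continuousB; first exact: y_cont.
  exact: is_vprimitive_continuous sol_prim a s.
by rewrite mul0r => /eqP; rewrite subr_eq0 => /eqP.
Unshelve. all: by end_near. Qed.

(** From time [tau] on the whole window lies in [0, +oo[, where [sol] and [x] agree; earlier windows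
    reach into the initial function. *)
Lemma sol_ode t : tau <= t ->
  sol_deriv t = A *m sol t + Ad1 *m sol (t - tau) + Ad2 *m vmom tau 1 sol t.
Proof.
move=> tt; have t0 : 0 <= t by rewrite (le_trans _ tt)// ltW.
have tn s : 0 <= s -> - tau <= s by apply: le_trans; rewrite oppr_le0 ltW.
rewrite /sol_deriv /velocity !extendE ?tn// ?subr_ge0// !solE ?subr_ge0//.
congr (_ + _ *m _); apply: vmom1_eq => //.
  exact: is_vprimitive_continuous sol_prim.
move=> s /andP[ts _]; have s0 : 0 <= s by rewrite (le_trans _ ts)// subr_ge0.
by rewrite extendE ?tn// solE.
Qed.

(* On a step of length h with growth * h <= 1/2, the mean value theorem at a
   point of maximal norm shows that the norm at most doubles. *)
Lemma extend_step t h B : 0 <= t -> 0 <= h -> 0 <= B -> growth * h <= 2^-1 ->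
  (forall s, s <= t -> `|y s| <= B) -> forall s, s <= t + h -> `|y s| <= 2 * B.
Proof.
move=> t0 h0 B0 gh yB; have th : t <= t + h by rewrite lerDl.
have [|r] := @EVT_max _ (fun s => `|y s|) t (t + h) th.
  apply: continuous_subspaceT => s; apply: continuous_comp; last exact: norm_continuous.
  exact: continuous_extend.
rewrite in_itv /= => /andP[tr rh] rmax.
suff yr : `|y r| <= 2 * B.
  move=> s sh; have [st|/ltW ts] := leP s t.
    by apply: le_trans (yB s st) _; lra.
  by apply: le_trans yr; apply: rmax; rewrite in_itv /= ts.
rewrite leNgt; apply/negP => Br; pose G := `|y r|.
have G0 : 0 <= G by exact: normr_ge0.
have yG s : s <= r -> `|y s| <= G.
  move=> sr; have [st|/ltW ts] := leP s t.
    by apply: le_trans (yB s st) _; rewrite /G; lra.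
  by apply: rmax; rewrite in_itv /= ts (le_trans sr).
(* With G > 2 B this is absurd. The entries of y(r) differ from those of y(t) by at most growth * G
   * h <= G / 2. *)
have : G <= B + G / 2.
  apply: mx_norm_le; first lra.
  move=> a j; rewrite ord1.
  have [c /andP[tc cr]] := is_primitive_MVT (sol_prim a) tr.
  have tn s : 0 <= s -> - tau <= s by apply: le_trans; rewrite oppr_le0 ltW.
  have r0 : 0 <= r by rewrite (le_trans t0).
  rewrite !solE// => E.
  have dc : `|sol_deriv c a 0| <= growth * G.
    apply: velocity_le => // s b /andP[_ sc].
    by apply: le_trans (normr_entry_le _ _ _) (yG _ (le_trans sc cr)).
  have -> : y r a 0 = y t a 0 + sol_deriv c a 0 * (r - t).
    by rewrite -E /y !extendE ?tn// addrC subrK.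
  apply: le_trans (ler_normD _ _) _; apply: lerD.
    by apply: le_trans (normr_entry_le _ _ _) _; exact: yB.
  rewrite normrM (ger0_norm (_ : 0 <= r - t)) ?subr_ge0//.
  apply: (@le_trans _ _ (growth * G * h)).
    by apply: ler_pM => //; rewrite ?subr_ge0// lerBlDl.
  by rewrite mulrAC mulrC ler_wpM2l.
rewrite /G; lra.
Qed.

End Solutions.

(** * Uniform bounds, stability and attractivity *)

Section Stability.
Variables (R : realType) (n : nat) (tau : R) (A Ad1 Ad2 : 'M[R]_n).
Hypothesis tau_gt0 : 0 < tau.
Local Notation sol := (sol tau A Ad1 Ad2).
Local Notation sol_deriv := (sol_deriv tau A Ad1 Ad2).
Local Notation growth := (growth tau A Ad1 Ad2).

(** Cut [0, tau] into [N] steps short enough for [extend_step]: the norm grows at most by 2^N. The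
    factor 1 + growth serves the state and its derivative at once. *)
Lemma early_bound : exists2 K, 0 <= K & forall phi x d,
  delay_solution tau A Ad1 Ad2 phi x -> 0 <= d ->
  (forall s, - tau <= s <= 0 -> `|x s| <= d) ->
  forall s a, 0 <= s <= tau -> `|sol x s a 0| <= K * d /\ `|sol_deriv x s a 0| <= K * d.
Proof.
have g0 : 0 <= growth by exact: growth_ge0.
pose N := Num.bound (2 * growth * tau).
have gN : 2 * growth * tau < N%:R by apply: archi_boundP; rewrite !mulr_ge0// ltW.
have N0 : 0 < N%:R :> R by apply: le_lt_trans gN; rewrite !mulr_ge0// ltW.
pose h := tau / N%:R; have h0 : 0 <= h by rewrite divr_ge0 ?ltW.
have gh : growth * h <= 2^-1.
  by rewrite /h mulrA ler_pdivrMr//; lra.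
exists ((1 + growth) * 2 ^+ N) => [|phi x d [xc _ xd _] d0 xs].
  by rewrite mulr_ge0 ?addr_ge0// exprn_ge0.
(* For k = 0 the bound holds on all of the past, since the extension is constant before - tau. *)
have yB k s : s <= h *+ k -> `|extend tau x s| <= 2 ^+ k * d.
  elim: k s => [|k IH] s sk.
    by rewrite mul1r; apply: xs; rewrite le_max lexx orbT ge_max sk oppr_le0 ltW.
  rewrite exprS -mulrA; apply: (extend_step tau_gt0 xc xd (mulrn_wge0 k h0) h0 _ gh IH).
    by rewrite mulr_ge0// exprn_ge0.
  by rewrite -mulrSr.
have Nh : h *+ N = tau by rewrite /h -mulr_natr divfK// gt_eqF.
have {}yB s : s <= tau -> `|extend tau x s| <= 2 ^+ N * d.
  by move=> st; apply: yB; rewrite Nh.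
have B0 : 0 <= 2 ^+ N * d by rewrite mulr_ge0// exprn_ge0.
move=> s a /andP[s0 st]; split.
  rewrite solE// -(@extendE _ _ tau) ?(le_trans _ s0) ?oppr_le0 ?(ltW tau_gt0)//.
  apply: le_trans (normr_entry_le _ _ _) _; apply: le_trans (yB _ st) _.
  by rewrite -mulrA mulrDl mul1r lerDl mulr_ge0.
apply: (@le_trans _ _ (growth * (2 ^+ N * d))).
  apply: velocity_le => //.
    move=> b r; apply: (@continuous_comp _ _ _ (extend tau x) (fun u : 'cV[R]_n => u b 0)).
      exact: continuous_extend.
    exact: coord_continuous.
  move=> r b /andP[_ rs]; apply: le_trans (normr_entry_le _ _ _) (yB _ _).
  exact: le_trans rs st.
by rewrite -[leRHS]mulrA mulrDl mul1r lerDr.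
Qed.

Variables (M m1 m2 : nat) (nu1 nu2 : nat -> nat).
Variables (P : 'M[R]_((1 + M) * n)) (Q Rm : nat -> 'M[R]_n).
Hypotheses (M_gt0 : (0 < M)%N)
  (nu1M : forall j, (j <= m1)%N -> (m1 + nu1 j < M)%N)
  (nu2M : forall j, (j <= m2)%N -> (m2 + nu2 j <= M)%N)
  (Qspd : forall j, (j <= m1)%N -> spd (Q j))
  (Rspd : forall j, (1 <= j <= m2)%N -> spd (Rm j))
  (Psi_pos : posdef (Psi0 tau m1 nu1 P Q))
  (Psi_neg : negdef (Psi1 tau A Ad1 Ad2 P + Psi2 M m1 nu1 Q
                + Psi31 M tau m2 A Ad1 Ad2 Rm - Psi32 M tau m2 nu2 Rm)).

Local Notation V x := (krasovskii tau (sol x) (sol_deriv x) m1 m2 P Q Rm).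
Local Notation W x := (krasovskii_deriv tau (sol x) (sol_deriv x) m1 m2 P Q Rm).

(** Both [eta] and [zvec] begin with the block z(t), so the lower bounds for the two definite forms
    can be read on its entries. *)
Lemma krasovskii_decay : exists2 c, 0 < c & forall phi x t a,
  delay_solution tau A Ad1 Ad2 phi x -> tau <= t ->
  c * sol x t a 0 ^+ 2 <= V x t /\ W x t <= - (c * sol x t a 0 ^+ 2).
Proof.
have [c1 c10 c1P] := posdef_lower_bound Psi_pos.
pose Psi := Psi1 tau A Ad1 Ad2 P + Psi2 M m1 nu1 Q
                + Psi31 M tau m2 A Ad1 Ad2 Rm - Psi32 M tau m2 nu2 Rm.
have [c2 c20 c2P] : exists2 c : R, 0 < c &
      forall (u : 'cV[R]_((1 + (1 + M)) * n)) i, c * u i 0 ^+ 2 <= bf (- Psi) u u.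
  apply: posdef_lower_bound => u u0; rewrite -/(bf _ _ _) bfNm oppr_gt0.
  exact: Psi_neg.
exists (Num.min (tau^-1 * c1) c2) => [|phi x t a [xc _ xd _] tt].
  by rewrite lt_min c20 mulr_gt0 ?invr_gt0.
have vc : vcontinuous (sol_deriv x) by exact: sol_deriv_cont.
have zv : is_vprimitive (sol x) (sol_deriv x) by exact: sol_prim.
set zt := sol x t a 0; have zt0 : 0 <= zt ^+ 2 by exact: sqr_ge0.
split.
  apply: le_trans (krasovskii_ge tau_gt0 vc zv P nu1M Qspd Rspd t).
  apply: (@le_trans _ _ (tau^-1 * c1 * zt ^+ 2)).
    by rewrite ler_wpM2r// ge_min lexx.
  rewrite -mulrA ler_wpM2l ?invr_ge0 ?(ltW tau_gt0)//.
  have := c1P (eta M tau (sol x) t) (lshift (M * n) a).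
  by rewrite col_mxEu.
apply: le_trans (krasovskii_deriv_le tau_gt0 M_gt0 vc zv P nu1M nu2M Qspd Rspd _) _.
  exact: sol_ode.
rewrite -/Psi lerNr -bfNm; apply: (@le_trans _ _ (c2 * zt ^+ 2)).
  by rewrite ler_wpM2r// ge_min lexx orbT.
have := c2P (zvec M tau (sol x) t) (lshift ((1 + M) * n) a).
by rewrite col_mxEu.
Qed.

(** Up to [tau] this is [early_bound]. Afterwards c z(s)^2 <= V(s) <= V(tau) <= C (K d)^2, whence
    the term with the square root; at [tau] the window is exactly [0, tau]. *)
Lemma sol_bound : exists2 L, 0 <= L & forall phi x d,
  delay_solution tau A Ad1 Ad2 phi x -> 0 <= d ->
  (forall s, - tau <= s <= 0 -> `|x s| <= d) ->
  forall s a, 0 <= s -> `|sol x s a 0| <= L * d.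
Proof.
have [K K0 KP] := early_bound.
have [c c0 cP] := krasovskii_decay.
have [C C0 CP] := krasovskii_le m1 m2 P Q Rm tau_gt0.
exists (K + Num.sqrt (C / c) * K) => [|phi x d sx d0 xd s a s0].
  by rewrite addr_ge0// mulr_ge0// sqrtr_ge0.
have [xc _ xder _] := sx.
have vc : vcontinuous (sol_deriv x) by exact: sol_deriv_cont.
have zv : is_vprimitive (sol x) (sol_deriv x) by exact: sol_prim.
have Kd0 : 0 <= K * d by rewrite mulr_ge0.
rewrite mulrDl -mulrA; have [st|/ltW ts] := leP s tau.
  by apply: le_trans (KP _ _ _ sx d0 xd s a _).1 _; rewrite ?s0// lerDl mulr_ge0 ?sqrtr_ge0.
have VC : V x tau <= C * (K * d) ^+ 2.
  apply: CP => //; first exact: is_vprimitive_continuous zv.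
  by move=> r b; rewrite subrr; exact: KP sx d0 xd r b.
have VV : V x s <= V x tau.
  apply: (is_primitive_nincr (krasovskii_prim tau_gt0 vc zv m1 m2 P Q Rm) _ (lexx tau) ts).
  move=> t tt; apply: le_trans (cP _ _ t a sx tt).2 _.
  by rewrite oppr_le0 mulr_ge0 ?sqr_ge0// ltW.
have zV := (cP _ _ s a sx ts).1.
rewrite -[leLHS]add0r lerD// -[leLHS]sqrtr_sqr -[X in _ * X]ger0_norm// -[X in _ * X]sqrtr_sqr.
rewrite -sqrtrM ?divr_ge0// ?(ltW c0)// ler_wsqrtr// mulrAC ler_pdivlMr// mulrC.
by apply: le_trans zV (le_trans VV VC).
Qed.

Lemma krasovskii_stability : asymptotically_stable tau A Ad1 Ad2.
Proof.
have [L L0 LP] := sol_bound.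
have [c c0 cP] := krasovskii_decay.
have xs (phi x : R -> 'cV[R]_n) (d : R) : Defs.initial_ball tau d phi ->
    delay_solution tau A Ad1 Ad2 phi x -> forall s, - tau <= s <= 0 -> `|x s| <= d.
  by move=> [_ pd] [_ xp _ _] s st; rewrite xp// ltW// pd.
split.
  (* Adding 1 keeps the denominator positive and makes L d < e strict. *)
  move=> e e0; exists (e / (L + 1)); first by rewrite divr_gt0// ltr_wpDl.
  move=> phi x pd sx t t0; apply: mx_norm_lt => // i j; rewrite ord1.
  have d0 : 0 <= e / (L + 1) by rewrite divr_ge0 ?addr_ge0// ltW.
  have := LP _ _ _ sx d0 (xs _ _ _ pd sx) t i t0.
  have [xc _ xder _] := sx.
  rewrite solE// => /le_lt_trans; apply.
  by rewrite mulrCA gtr_pMr// ltr_pdivrMr; lra.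
exists 1 => // phi x pd sx.
have [xc _ xder _] := sx.
have vc : vcontinuous (sol_deriv x) by exact: sol_deriv_cont.
have zv : is_vprimitive (sol x) (sol_deriv x) by exact: sol_prim.
have zL s a : 0 <= s -> `|sol x s a 0| <= L.
  by move=> s0; rewrite -[L]mulr1; exact: LP sx ler01 (xs _ _ _ pd sx) s a s0.
(* The function for Barbalat's argument. The decay estimate concerns one entry at a time, so it is
   summed over the [n] entries and [f] is compared with [n] copies of the functional. *)
pose f t := c * \sum_a sol x t a 0 ^+ 2.
pose f' t := c * \sum_a (2 * (sol x t a 0 * sol_deriv x t a 0)).
have ff : is_primitive f f'.
  apply: is_primitiveZ; apply: is_primitive_sum => a _ t.
  have := is_primitiveM (zv a) (zv a) t; rewrite [X in _ + X]mulrC => h.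
  by rewrite mulr2n mulrDl mul1r mulrC.
pose D := c * \sum_(a < n) 2 * (L * (growth * L)).
have g0 : 0 <= growth by exact: growth_ge0.
have D0 : 0 <= D by rewrite mulr_ge0 ?(ltW c0)// sumr_ge0// => a _; rewrite !mulr_ge0.
have t0 t : tau <= t -> 0 <= t by apply: le_trans; exact: ltW.
(* [D] itself may vanish, and the argument divides by the slope bound. *)
have f'D t : tau <= t -> `|f' t| <= D + 1.
  move=> tt; apply: (@le_trans _ _ D); last by rewrite lerDl.
  rewrite normrM (gtr0_norm c0) ler_pM2l//.
  apply: le_trans (ler_norm_sum _ _ _) _; apply: ler_sum => a _.
  rewrite !normrM (ger0_norm (ler0n _ 2)) ler_pM2l ?ltr0n//; apply: ler_pM => //.
    by apply: zL; exact: t0.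
  rewrite sol_ode//; apply: velocity_le => //.
    exact: is_vprimitive_continuous zv.
  by move=> r b /andP[tr _]; apply: zL; apply: le_trans tr; rewrite subr_ge0.
have nE (u : R) : n%:R * u = \sum_(a < n) u by rewrite sumr_const card_ord mulr_natl.
have W0 t : tau <= t -> 0 <= n%:R * V x t.
  move=> tt; rewrite nE; apply: sumr_ge0 => a _.
  by apply: le_trans (cP _ _ t a sx tt).1; rewrite mulr_ge0 ?sqr_ge0// ltW.
have wf t : tau <= t -> n%:R * W x t <= - f t.
  move=> tt; rewrite nE /f mulr_sumr -sumrN; apply: ler_sum => a _.
  exact: (cP _ _ t a sx tt).2.
have f0 t : tau <= t -> 0 <= f t.
  by move=> _; rewrite mulr_ge0 ?(ltW c0)// sumr_ge0// => a _; exact: sqr_ge0.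
have Vn := is_primitiveZ n%:R (krasovskii_prim tau_gt0 vc zv m1 m2 P Q Rm).
apply/cvgrPdist_lt => e e0.
(* Once [f] is below this level, every entry of x(t) is less than [e] in absolute value. *)
have ce0 : 0 < c * e ^+ 2 by rewrite mulr_gt0// exprn_gt0.
have [T tT Tf] := barbalat Vn ff (ltr_wpDl D0 ltr01) W0 f0 wf f'D ce0.
exists T; split; first exact: num_real.
move=> t Tt /=; rewrite sub0r normrN; apply: mx_norm_lt => // i j; rewrite ord1.
have tt := le_trans tT (ltW Tt).
rewrite -(solE tau_gt0 xc xder (t0 _ tt)) -[ltRHS]gtr0_norm// -ltr_sqr ?nnegrE//.
rewrite !real_normK ?num_real// -(ltr_pM2l c0); apply: le_lt_trans (Tf t (ltW Tt)).
rewrite /f ler_pM2l// (bigD1 i)//= lerDl sumr_ge0// => a _; exact: sqr_ge0.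
Qed.

End Stability.

Theorem theorem1 (R : realType) (nx : nat) (hnx : (1 <= nx)%N)
    (A Ad1 Ad2 : 'M[R]_nx) (tau : R) (htau : 0 < tau)
    (M m1 m2 : nat) (hM : (0 < M)%N) (hm2 : (1 <= m2)%N)
    (nu1 nu2 : nat -> nat)
    (hnu1 : forall j, (j <= m1)%N -> (m1 + nu1 j < M)%N)
    (hnu2 : forall j, (j <= m2)%N -> (m2 + nu2 j <= M)%N) :
  (exists (P : 'M[R]_((1 + M) * nx)) (Q Rm : nat -> 'M[R]_nx),
    [/\ P^T = P,
        forall j, (j <= m1)%N -> spd (Q j),
        forall j, (1 <= j <= m2)%N -> spd (Rm j),
        posdef (Psi0 tau m1 nu1 P Q) &
        negdef (Psi1 tau A Ad1 Ad2 P + Psi2 M m1 nu1 Q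
                + Psi31 M tau m2 A Ad1 Ad2 Rm - Psi32 M tau m2 nu2 Rm)]) ->
  asymptotically_stable tau A Ad1 Ad2.
Proof.
case=> P [Q [Rm [_ Qspd Rspd Psi_pos Psi_neg]]].
exact: (krasovskii_stability htau hM hnu1 hnu2 Qspd Rspd Psi_pos Psi_neg).
Qed.
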